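(* Let $A$ be a finite dimensional algebra over a field $k$ which is basic and indecomposable as an $A$-$A$-bimodule. Let $e\in A$ be a primitive idempotent with corresponding simple $A$-module $S$, and assume that $\mathrm{Ext}^1_A(S,S)=0$, that the projective dimension of $\tau^{-1}S$ is at most $1$, and that $S$ is not injective. Let $T:=\tau^{-1}S\oplus(1-e)A$ be the BB tilting module with respect to $e$. (a) $T$ is isomorphic (in $\mathsf{K}^{\rm b}(\mathrm{proj}\text{-}A)$) to the left mutation $\mu^+_{eA}(A)$ of $A$ with respect to $eA$. (b) $T$ is a tilting $A$-module of projective dimension at most one.
   Context: Modules are finitely generated right modules. $S$ is the top of the indecomposable projective module $eA$. $\tau^{-1}$ is the inverse Auslander-Reiten translation. $\mathcal{T}=\mathsf{K}^{\rm b}(\mathrm{proj}\text{-}A)$ is the homotopy category of bounded complexes of finitely generated projective right $A$-modules; a module of finite projective dimension is regarded as an object of $\mathcal{T}$ via a projective resolution. An $A$-module $T$ is a tilting module of projective dimension at most one if $\mathrm{pd}\,T\le1$, $\mathrm{Ext}^1_A(T,T)=0$, and the number of non-isomorphic indecomposable summands of $T$ equals that of $A$. An object $M\in\mathcal{T}$ is silting if $\mathrm{Hom}_{\mathcal{T}}(M,M[i])=0$ for all $i>0$ and the smallest thick subcategory containing $M$ is $\mathcal{T}$; $A$ is a silting object. Left mutation: for a basic silting object $M=X\oplus M'$, take a triangle $X\xrightarrow{f}D\to N\to X[1]$ where $f$ is a minimal left $\mathrm{add}\,M'$-approximation of $X$ (i.e. $D\in\mathrm{add}\,M'$, $\mathrm{Hom}_{\mathcal{T}}(f,D')$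 is surjective for all $D'\in\mathrm{add}\,M'$, and any $h:D\to D$ with $hf=f$ is an isomorphism), where $\mathrm{add}\,M'$ is the closure of $M'$ under finite coproducts, summands and isomorphisms; then $\mu^+_X(M):=N\oplus M'$. Here $M=A=eA\oplus(1-e)A$ and $X=eA$. *)

(* Defs.v *)
From HB Require Import structures.
From mathcomp Require Import all_boot all_order all_algebra all_field.

Set Implicit Arguments.
Unset Strict Implicit.
Unset Printing Implicit Defensive.

Import GRing.Theory.
Local Open Scope ring_scope.

(* A left R-module is an [lmodType R]; a right A-module is an [lmodType A^c]
   over the converse ring, the right action m.a being (a : A^c) *: m.
   Submodules are Prop-valued predicates. *)

Definition mk_linear (R : nzRingType) (U V : lmodType R) (f : U -> V)
  (lf : linear f) : {linear U -> V} :=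
  HB.pack f (GRing.isLinear.Build R U V *:%R f lf).

Section Modules.
Variable R : nzRingType.
Implicit Types L M N P X Y Z : lmodType R.

Definition zero_mod : lmodType R := 'rV[R]_0.

Definition surj (U V : Type) (f : U -> V) : Prop := forall y, exists x, f x = y.

Definition iso_mod M N : Prop :=
  exists (f : {linear M -> N}) (g : {linear N -> M}), cancel f g /\ cancel g f.

Definition is_zero M : Prop := forall x : M, x = 0.

Definition fin_gen M : Prop :=
  exists (n : nat) (v : 'I_n -> M),
    forall x, exists a : 'I_n -> R, x = \sum_i a i *: v i.

Definition projective P : Prop :=
  forall X Y (g : {linear X -> Y}) (f : {linear P -> Y}),
    surj g -> exists h : {linear P -> X}, forall x, g (h x) = f x.

Definition injective_mod M : Prop :=
  forall X Y (i : {linear X -> Y}) (f : {linear X -> M}),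
    injective i -> exists h : {linear Y -> M}, forall x, h (i x) = f x.

Definition is_summand X M : Prop := exists Y, iso_mod M (X * Y)%type.

Definition indecomposable M : Prop :=
  ~ is_zero M /\ forall X Y, iso_mod M (X * Y)%type -> is_zero X \/ is_zero Y.

Definition num_indec_summands M (n : nat) : Prop :=
  exists X : 'I_n -> lmodType R,
    [/\ forall i, indecomposable (X i) /\ is_summand (X i) M,
        forall i j, iso_mod (X i) (X j) -> i = j
      & forall Y, indecomposable Y -> is_summand Y M -> exists i, iso_mod Y (X i)].

Definition is_submod M (U : M -> Prop) : Prop :=
  U 0 /\ forall (a : R) x y, U x -> U y -> U (a *: x + y).

Definition is_maximal M (U : M -> Prop) : Prop :=
  [/\ is_submod U, exists x, ~ U x
    & forall V, is_submod V -> (forall x, U x -> V x) ->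
        (forall x, V x -> U x) \/ (forall x, V x)].

Definition radical M (x : M) : Prop :=
  forall U : M -> Prop, is_maximal U -> U x.

Definition is_top M N : Prop :=
  exists p : {linear M -> N}, surj p /\ forall x, p x = 0 <-> radical x.

Definition superfluous M (K : M -> Prop) : Prop :=
  forall U, is_submod U ->
    (forall x, exists u k, [/\ U u, K k & x = u + k]) -> forall x, U x.

(* P1 -p1-> P0 -p0-> M -> 0 is exact, and p0 : P0 -> M and p1 : P1 -> ker p0
   are projective covers. *)
Definition min_proj_presentation M P0 P1
    (p1 : {linear P1 -> P0}) (p0 : {linear P0 -> M}) : Prop :=
  [/\ (fin_gen P0 /\ projective P0) /\ (fin_gen P1 /\ projective P1),
      surj p0,
      forall x, p0 x = 0 <-> exists y, p1 y = x,
      superfluous (fun x => p0 x = 0)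
    & superfluous (fun y => p1 y = 0)].

End Modules.

(* Complexes are cohomologically graded: the differential raises degree. *)
Section Complexes.
Variable R : nzRingType.

Record complex := Complex {
  obj :> int -> lmodType R;
  diff : forall i, {linear obj i -> obj (i + 1)};
  diffK : forall i x, diff (i + 1) (diff i x) = 0 }.

Implicit Types C D E X Y Z : complex.

Record chmap C D := Chmap {
  comp :> forall i, {linear C i -> D i};
  chmapP : forall i x, comp (i + 1) (diff C i x) = diff D i (comp i x) }.

(* The homotopy component h i goes from degree i + 1 to degree i. *)
Definition homotopic C D (f g : chmap C D) : Prop :=
  exists h : forall i, {linear C (i + 1) -> D i},
    forall i x, f (i + 1) x - g (i + 1) x
                = diff D i (h i x) + h (i + 1) (diff C (i + 1) x).

Definition idC C : chmap C C :=
  @Chmap C C (fun i => idfun) (fun i x => erefl).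

Definition compC C D E (g : chmap D E) (f : chmap C D) : chmap C E.
Proof.
exists (fun i => g i \o f i : {linear C i -> E i}) => i x /=.
by rewrite !chmapP.
Defined.

(* Isomorphisms in the homotopy category. *)
Definition is_isoK C D (f : chmap C D) : Prop :=
  exists g : chmap D C,
    homotopic (compC g f) (idC C) /\ homotopic (compC f g) (idC D).

Definition isoK C D : Prop := exists f : chmap C D, is_isoK f.

Definition stalk_obj (M : lmodType R) (i : int) : lmodType R :=
  if i is Posz 0 then M else zero_mod R.

(* The module M placed in degree 0. *)
Definition stalk (M : lmodType R) : complex :=
  @Complex (stalk_obj M) (fun i => \0) (fun i x => erefl).

Definition shift C : complex.
Proof.
exists (fun i => C (i + 1)) (fun i => \- diff C (i + 1)) => i x /=.
by rewrite linearN diffK oppr0 oppr0.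
Defined.

Definition shift_map C D (f : chmap C D) : chmap (shift C) (shift D).
Proof.
exists (fun i => f (i + 1)) => i x /=.
by rewrite linearN chmapP.
Defined.

Definition dsumC_diff C D (i : int) (x : (C i * D i)%type) :
  (C (i + 1)%R * D (i + 1)%R)%type := (diff C i x.1, diff D i x.2).

Fact dsumC_diff_linear C D i : linear (@dsumC_diff C D i).
Proof. by move=> a x y; rewrite /dsumC_diff /= !linearP. Qed.

Definition dsumC C D : complex.
Proof.
exists (fun i => (C i * D i)%type) (fun i => mk_linear (@dsumC_diff_linear C D i)).
by move=> i x; rewrite /= /dsumC_diff /= !diffK.
Defined.

Definition cone_diff C D (f : chmap C D) (i : int) (x : (C (i + 1)%R * D i)%type) :
  (C (i + 1 + 1)%R * D (i + 1)%R)%type :=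
  (- diff C (i + 1) x.1, f (i + 1) x.1 + diff D i x.2).

Fact cone_diff_linear C D (f : chmap C D) i : linear (@cone_diff C D f i).
Proof.
move=> a x y; rewrite /cone_diff /= !linearP /=; congr pair.
by rewrite addrACA -scalerDr.
Qed.

Definition cone C D (f : chmap C D) : complex.
Proof.
exists (fun i => (C (i + 1)%R * D i)%type)
       (fun i => mk_linear (@cone_diff_linear C D f i)).
move=> i x; rewrite /= /cone_diff /= linearN diffK !oppr0; congr pair.
by rewrite linearN linearD diffK addr0 chmapP addNr.
Defined.

Fact cone_in_linear C D i : linear (fun y : D i => (0, y) : (C (i + 1)%R * D i)%type).
Proof. by move=> a x y; congr pair; rewrite [RHS]addr0 [RHS]scaler0. Qed.

Definition cone_in C D (f : chmap C D) : chmap D (cone f).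
Proof.
exists (fun i => mk_linear (@cone_in_linear C D i) : {linear D i -> cone f i}).
by move=> i x; rewrite /= /cone_diff /= !raddf0 add0r; congr pair; rewrite ?oppr0.
Defined.

Fact cone_out_linear C D i : linear (fun x : (C (i + 1)%R * D i)%type => x.1).
Proof. by []. Qed.

Definition cone_out C D (f : chmap C D) : chmap (cone f) (shift C).
Proof.
by exists (fun i => mk_linear (@cone_out_linear C D i) : {linear cone f i -> shift C i}).
Defined.

(* X -f-> Y -g-> Z -h-> X[1] is distinguished if it is isomorphic to a
   standard triangle X' -f'-> Y' -> cone f' -> X'[1]. *)
Definition distinguished X Y Z
    (f : chmap X Y) (g : chmap Y Z) (h : chmap Z (shift X)) : Prop :=
  exists (X' Y' : complex) (f' : chmap X' Y')
         (a : chmap X X') (b : chmap Y Y') (c : chmap Z (cone f')),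
    [/\ [/\ is_isoK a, is_isoK b & is_isoK c],
        homotopic (compC b f) (compC f' a),
        homotopic (compC c g) (compC (cone_in f') b)
      & homotopic (compC (shift_map a) h) (compC (cone_out f') c)].

(* The objects of K^b(proj R). *)
Definition in_Kb_proj C : Prop :=
  (forall i, fin_gen (C i) /\ projective (C i)) /\
  exists n : nat, forall i : int, (n < `|i|)%N -> is_zero (C i).

Inductive in_add (M : complex) : complex -> Prop :=
| add_gen : in_add M M
| add_zero : in_add M (stalk (zero_mod R))
| add_sum X Y : in_add M X -> in_add M Y -> in_add M (dsumC X Y)
| add_summand X Y : in_Kb_proj X -> in_Kb_proj Y ->
    in_add M (dsumC X Y) -> in_add M X
| add_iso X Y : in_Kb_proj Y -> isoK X Y -> in_add M X -> in_add M Y.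

Definition left_approx M' X D (f : chmap X D) : Prop :=
  in_add M' D /\
  forall D' (g : chmap X D'), in_add M' D' ->
    exists h : chmap D D', homotopic (compC h f) g.

Definition left_minimal X D (f : chmap X D) : Prop :=
  forall h : chmap D D, homotopic (compC h f) f -> is_isoK h.

(* L is isomorphic to the left mutation at X of M, where M = X (+) M'.
   The mutation is only determined up to isomorphism. *)
Definition is_left_mutation M X M' L : Prop :=
  in_Kb_proj L /\ isoK M (dsumC X M') /\
  exists (D N : complex) (f : chmap X D) (g : chmap D N) (h : chmap N (shift X)),
    [/\ in_Kb_proj N, left_approx M' f, left_minimal f, distinguished f g h
      & isoK L (dsumC N M')].

(* ... -> P^{-2} -> P^{-1} -> P^0 -eps-> M -> 0 is exact, with finitely
   generated projective terms.  The degrees are written with [Negz] and [Posz]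
   so that P (Negz 0 + 1) is convertible to P (Posz 0). *)
Definition proj_resolution (P : complex) (M : lmodType R)
    (eps : {linear P (Posz 0) -> M}) : Prop :=
  [/\ forall i, fin_gen (P i) /\ projective (P i),
      forall i : int, (0 < i) -> is_zero (P i),
      surj eps,
      forall x : P (Posz 0), eps x = 0 <-> exists y, diff P (Negz 0) y = x
    & forall i : int, i + 1 < 0 ->
        forall x : P (i + 1), diff P (i + 1) x = 0 <-> exists y, diff P i y = x].

Definition pd_le (n : nat) (M : lmodType R) : Prop :=
  exists (P : complex) (eps : {linear P (Posz 0) -> M}),
    proj_resolution eps /\ forall i : int, i < - n%:Z -> is_zero (P i).

(* The first cohomology of Hom(P, N) vanishes, for P a projective resolution
   of M. *)
Definition Ext1_zero (M N : lmodType R) : Prop :=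
  forall (P : complex) (eps : {linear P (Posz 0) -> M}), proj_resolution eps ->
  forall phi : {linear P (Negz 0) -> N},
    (forall x : P (Negz 1), phi (diff P (Negz 1) x) = 0) ->
    exists psi : {linear P (Posz 0) -> N},
      forall x : P (Negz 0), phi x = psi (diff P (Negz 0) x).

(* C is the object of K^b(proj R) that the module M is regarded as. *)
Definition represents C (M : lmodType R) : Prop :=
  in_Kb_proj C /\ exists eps : {linear C (Posz 0) -> M}, proj_resolution eps.

Definition is_tilting_pd1 (T : lmodType R) : Prop :=
  [/\ fin_gen T, pd_le 1 T, Ext1_zero T T
    & exists n : nat, num_indec_summands T n /\
                      num_indec_summands (R^o : lmodType R) n].

End Complexes.

Section Algebra.
Variables (k : fieldType) (A : falgType k).

Definition right_mod := lmodType A^c.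
Definition left_mod := lmodType A.

Definition reg_right : right_mod := (A^c)^o.

Definition ract (M : right_mod) (m : M) (a : A) : M := (a : A^c) *: m.

(* The right ideal eA, as the image of left multiplication by e. *)
Section PrincipalRightIdeal.
Variable e : A.

Definition in_eA : {pred (A^c)^o} := fun x => (x : A) \in limg (amull e).

Fact in_eA_submod : submod_closed in_eA.
Proof.
split; first exact: (mem0v (limg (amull e))).
move=> a x y; rewrite !unfold_in => /memv_imgP[u _ xE] /memv_imgP[v _ yE].
apply/memv_imgP; exists (u * a + v); first exact: memvf.
move: xE yE; rewrite !lfunE /= => -> ->.
by rewrite mulrDr mulrA.
Qed.
HB.instance Definition _ :=
  GRing.isSubmodClosed.Build A^c (A^c)^o in_eA in_eA_submod.

Definition eA_type := {x : (A^c)^o | in_eA x}.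
HB.instance Definition _ := SubChoice.on eA_type.
HB.instance Definition _ := [SubChoice_isSubLmodule of eA_type by <:].

Definition eA : right_mod := eA_type.

End PrincipalRightIdeal.

Definition idempotent (e : A) : Prop := e * e = e.

Definition primitive_idempotent (e : A) : Prop :=
  [/\ idempotent e, e != 0
    & forall f g : A, idempotent f -> idempotent g -> f * g = 0 -> g * f = 0 ->
        e = f + g -> f = 0 \/ g = 0].

Definition basic_algebra : Prop :=
  exists (n : nat) (f : 'I_n -> A),
    [/\ forall i, primitive_idempotent (f i),
        forall i j, i != j -> f i * f j = 0,
        \sum_i f i = 1
      & forall i j, iso_mod (eA (f i)) (eA (f j)) -> i = j].

Definition is_subbimod (I : A -> Prop) : Prop :=
  [/\ I 0, forall x y, I x -> I y -> I (x + y)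
    & forall a b x, I x -> I (a * x * b)].

Definition indecomposable_bimod : Prop :=
  (1 : A) <> 0 /\
  forall I J, is_subbimod I -> is_subbimod J ->
    (forall x, I x -> J x -> x = 0) ->
    (forall x, exists y z, [/\ I y, J z & x = y + z]) ->
    (forall x, I x -> x = 0) \/ (forall x, J x -> x = 0).

(* The left module L is the k-dual Hom_k(M, k) of the right module M, the
   evaluation pairing being b; k acts on M through k -> A. *)
Definition is_dual (M : right_mod) (L : left_mod) : Prop :=
  exists b : L -> M -> k,
    [/\ forall l l' m, b (l + l') m = b l m + b l' m,
        forall l, (forall m m', b l (m + m') = b l m + b l m') /\
                  (forall (c : k) m, b l (ract m c%:A) = c * b l m),
        forall (a : A) l m, b (a *: l) m = b l (ract m a),
        forall l, (forall m, b l m = 0) -> l = 0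
      & forall phi : M -> k,
          (forall m m', phi (m + m') = phi m + phi m') ->
          (forall (c : k) m, phi (ract m c%:A) = c * phi m) ->
          exists l, forall m, phi m = b l m].

(* N = Tr L: the cokernel of Hom_A(p1, A) : Hom_A(P0, A) -> Hom_A(P1, A) for a
   minimal projective presentation of the left module L.  The right action on
   Hom_A(P, A) is (phi.a) x = phi x * a, and q is the cokernel map. *)
Definition is_transpose (L : left_mod) (N : right_mod) : Prop :=
  exists (P0 P1 : left_mod) (p1 : {linear P1 -> P0}) (p0 : {linear P0 -> L})
         (q : {linear P1 -> A^o} -> N),
    [/\ min_proj_presentation p1 p0,
        forall (a : A) (phi psi chi : {linear P1 -> A^o}),
          (forall x, chi x = (phi x : A) * a + psi x) ->
          q chi = ract (q phi) a + q psi,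
        surj q
      & forall phi, q phi = 0 <->
          exists psi : {linear P0 -> A^o}, forall x, phi x = psi (p1 x)].

(* N is (isomorphic to) the inverse Auslander-Reiten translate Tr D M. *)
Definition is_tau_inv (M N : right_mod) : Prop :=
  exists L : left_mod, is_dual M L /\ is_transpose L N.

End Algebra.

(* Main.v *)
(* Write D for the duality over k.  Applying Hom_A(-, A) to the minimal
   presentation P1 -> Ae -> DS -> 0 of left modules gives an exact sequence
   eA -f-> Hom_A(P1, A) -> tau^-1 S -> 0.  As A is basic, (1-e)DS = 0, so the
   image of P1 in Ae contains (1-e)Ae, and every map eA -> (1-e)A factors
   through f; as Ext^1(S, S) = 0, P1 is generated by (1-e)P1, so Hom_A(P1, A) is
   in add (1-e)A.  Hence f is a left add (1-e)A-approximation, and it is minimal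
   because the kernel of P1 -> Ae is superfluous.  If pd tau^-1 S <= 1, the
   image of f is a projective quotient of the local module eA, so f is injective
   or zero; if it were zero, DS would be projective and S injective.  The cone of
   f is therefore a projective resolution of tau^-1 S, which identifies T with
   the mutation, minimal approximations and projective resolutions being unique
   up to isomorphism in the homotopy category.  Every map eA -> T extends along
   f, so Ext^1(T, T) = 0; and tau^-1 S is indecomposable and not projective, so it
   replaces exactly the summand eA of A. *)
From HB Require Import structures.
From mathcomp Require Import all_boot all_order all_algebra all_field.
From mathcomp Require Import boolp classical_sets functions.
Require Import Defs.

Set Implicit Arguments.
Unset Strict Implicit.
Unset Printing Implicit Defensive.

Import GRing.Theory.
Local Open Scope ring_scope.

(** * Submodules and linear maps *)

(** The hypothesis Ext^1(S, S) = 0 concerns right modules, whereas P1 is a left module. The bridge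
    is a statement inside A: the radical of eA is generated, as a right ideal, by its products with
    1 - e on the right. Otherwise the radical would have S as a simple quotient, the quotient map
    would extend to eA, and yet every map eA -> S kills the radical. Basicness acts through
    multiplicities: eA occurs only once in A, so a second, orthogonal split embedding of eA is
    impossible. S, its dual and tau^-1 S come without a basis over k. Hence finite length is
    expressed by a rank function on submodules, locality and Krull-Schmidt come from Fitting's
    lemma, and the duality from extending linear functionals by Zorn's lemma. The bound on the
    projective dimension yields an endomorphism theta of eA with f theta = f that kills ker f; being
    injective or nilpotent, it makes f injective or zero. *)

Section Submodules.
Variables (R : nzRingType) (M : lmodType R).
Implicit Types U V : M -> Prop.

(** The proof of [is_submod U] is an argument so that the closure instance below can be attached to
    the predicate. *)
Definition sub_pred U of is_submod U : {pred M} := fun x => `[< U x >].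

Fact sub_pred_submod U (hU : is_submod U) : submod_closed (sub_pred hU).
Proof.
case: (hU) => U0 UD; split; first by apply/asboolP.
by move=> a x y /asboolP Ux /asboolP Uy; apply/asboolP; apply: UD.
Qed.

Section SubModule.
Variables (U : M -> Prop) (hU : is_submod U).

HB.instance Definition _ :=
  GRing.isSubmodClosed.Build R M (sub_pred hU) (sub_pred_submod hU).

Definition sub_mod_type := {x : M | sub_pred hU x}.
HB.instance Definition _ := SubChoice.on sub_mod_type.
HB.instance Definition _ := [SubChoice_isSubLmodule of sub_mod_type by <:].

Definition sub_mod : lmodType R := sub_mod_type.

(** The interface to submodules from here on: an injective linear map with prescribed image, which
    hides the subtype. *)
Lemma sub_modP : exists (X : lmodType R) (j : {linear X -> M}),
  injective j /\ forall x, U x <-> exists y, j y = x.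
Proof.
have lj : linear (fun x : sub_mod => \val x : M) by [].
exists sub_mod, (mk_linear lj); split; first exact: val_inj.
move=> x; split=> [/asboolP Ux|[y <-]]; first by exists (exist _ x Ux).
by have /asboolP := valP y.
Qed.

End SubModule.

Lemma submod0 U : is_submod U -> U 0. Proof. by case. Qed.
Lemma submodZ U a x : is_submod U -> U x -> U (a *: x).
Proof. by case=> U0 UP Ux; rewrite -[_ *: _]addr0; apply: UP. Qed.
Lemma submodD U x y : is_submod U -> U x -> U y -> U (x + y).
Proof. by case=> U0 UP Ux Uy; rewrite -[x]scale1r; apply: UP. Qed.
Lemma submodN U x : is_submod U -> U x -> U (- x).
Proof. by move=> hU Ux; rewrite -scaleN1r; apply: submodZ. Qed.
Lemma submodB U x y : is_submod U -> U x -> U y -> U (x - y).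
Proof. by move=> hU Ux Uy; apply: submodD => //; apply: submodN. Qed.
Lemma submod_sum U (I : Type) (r : seq I) (P : pred I) (F : I -> M) :
  is_submod U -> (forall i, P i -> U (F i)) -> U (\sum_(i <- r | P i) F i).
Proof.
move=> hU UF; apply: (big_ind U) => //; first exact: submod0.
by move=> x y; apply: submodD.
Qed.

End Submodules.

Section LinearMaps.
Variable R : nzRingType.
Implicit Types M N X Y : lmodType R.

(** Unique choice for linear maps: a total, single-valued, linear relation is a graph. Most maps
    below are defined by such a relation rather than by a formula. *)
Lemma linear_choice M N (r : M -> N -> Prop) :
  (forall x, exists y, r x y) ->
  (forall x y y', r x y -> r x y' -> y = y') ->
  (forall a x x' y y', r x y -> r x' y' -> r (a *: x + x') (a *: y + y')) ->
  exists f : {linear M -> N}, forall x, r x (f x).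
Proof.
move=> tot fn lin; have [f fP] := choice tot.
suff lf : linear f by exists (mk_linear lf).
by move=> a x y; apply: (fn (a *: x + y)) => //; apply: lin.
Qed.

Lemma linear_inj M N (f : {linear M -> N}) :
  (forall x, f x = 0 -> x = 0) -> injective f.
Proof.
by move=> h x y e; apply/eqP; rewrite -subr_eq0; apply/eqP/h; rewrite linearB e subrr.
Qed.

Lemma bij_inv M N (f : {linear M -> N}) : injective f -> surj f ->
  exists g : {linear N -> M}, cancel f g /\ cancel g f.
Proof.
move=> fI fS; have [g gP] := @linear_choice N M (fun y x => f x = y) fS
   (fun y x x' e e' => fI _ _ (etrans e (esym e')))
   (fun a y y' x x' e e' => etrans (linearP f a x x') (congr2 (fun u v => a *: u + v) e e')).
by exists g; split=> // x; apply: fI; rewrite gP.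
Qed.

Lemma bij_iso M N (f : {linear M -> N}) : injective f -> surj f -> iso_mod M N.
Proof. by move=> fI fS; have [g [? ?]] := bij_inv fI fS; exists f, g. Qed.

Lemma iso_sym M N : iso_mod M N -> iso_mod N M.
Proof. by case=> f [g [fK gK]]; exists g, f. Qed.

Lemma iso_trans M N X : iso_mod M N -> iso_mod N X -> iso_mod M X.
Proof.
case=> f [f' [fK f'K]] [g [g' [gK g'K]]].
exists (g \o f : {linear _ -> _}), (f' \o g' : {linear _ -> _}).
by split=> x /=; rewrite ?gK ?fK ?f'K ?g'K.
Qed.

Lemma ker_submod M N (f : {linear M -> N}) : is_submod (fun x => f x = 0).
Proof.
by split; [rewrite linear0 | move=> a x y fx fy; rewrite linearP fx fy scaler0 addr0].
Qed.

Lemma im_submod M N (f : {linear M -> N}) : is_submod (fun y => exists x, f x = y).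
Proof.
split; first by exists 0; rewrite linear0.
by move=> a _ _ [x <-] [y <-]; exists (a *: x + y); rewrite linearP.
Qed.

Lemma preim_submod M N (f : {linear M -> N}) U :
  is_submod U -> is_submod (fun x => U (f x)).
Proof.
move=> hU; split; first by rewrite linear0; apply: submod0.
by move=> a x y Ux Uy; rewrite linearP; case: hU => _; apply.
Qed.

Lemma add_submod M (U V : M -> Prop) : is_submod U -> is_submod V ->
  is_submod (fun x => exists u v, [/\ U u, V v & x = u + v]).
Proof.
move=> hU hV; split; first by exists 0, 0; split; [apply: submod0|apply: submod0|rewrite addr0].
move=> a _ _ [u [v [Uu Vv ->]]] [u' [v' [Uu' Vv' ->]]].
exists (a *: u + u'), (a *: v + v'); split; [by case: hU => _; apply|by case: hV => _; apply|].
by rewrite scalerDr addrACA.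
Qed.

Lemma line_submod M (x : M) : is_submod (fun y => exists a : R, y = a *: x).
Proof.
split; first by exists 0; rewrite scale0r.
by move=> a _ _ [b ->] [c ->]; exists (a * b + c); rewrite scalerA scalerDl.
Qed.

Lemma fst_linear_fact M N : linear (fun x : (M * N)%type => x.1). Proof. by []. Qed.
Definition pfst M N : {linear (M * N)%type -> M} := mk_linear (@fst_linear_fact M N).
Lemma snd_linear_fact M N : linear (fun x : (M * N)%type => x.2). Proof. by []. Qed.
Definition psnd M N : {linear (M * N)%type -> N} := mk_linear (@snd_linear_fact M N).

Lemma inl_linear_fact M N : linear (fun x => (x, 0) : (M * N)%type).
Proof. by move=> a x y; congr pair; rewrite /= scaler0 addr0. Qed.
Definition pinl M N : {linear M -> (M * N)%type} := mk_linear (@inl_linear_fact M N).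
Lemma inr_linear_fact M N : linear (fun x => (0, x) : (M * N)%type).
Proof. by move=> a x y; congr pair; rewrite /= scaler0 addr0. Qed.
Definition pinr M N : {linear N -> (M * N)%type} := mk_linear (@inr_linear_fact M N).

Lemma pinlrE M N (x : (M * N)%type) : x = pinl M N x.1 + pinr M N x.2.
Proof. by case: x => x y; congr pair; rewrite /= ?addr0 ?add0r. Qed.

Lemma pair_linear_fact X M N (f : {linear X -> M}) (g : {linear X -> N}) :
  linear (fun x => (f x, g x) : (M * N)%type).
Proof. by move=> a x y; rewrite !linearP. Qed.
Definition ppair X M N (f : {linear X -> M}) (g : {linear X -> N}) :
  {linear X -> (M * N)%type} := mk_linear (pair_linear_fact f g).

Lemma copair_linear_fact X M N (f : {linear M -> X}) (g : {linear N -> X}) :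
  linear (fun x : (M * N)%type => f x.1 + g x.2).
Proof. by move=> a x y; rewrite !linearP /= scalerDr addrACA. Qed.
Definition pcopair X M N (f : {linear M -> X}) (g : {linear N -> X}) :
  {linear (M * N)%type -> X} := mk_linear (copair_linear_fact f g).

Lemma retract_summand X M (i : {linear X -> M}) (r : {linear M -> X}) :
  cancel i r -> exists (Y : lmodType R) (j : {linear Y -> M}),
  [/\ iso_mod M (X * Y)%type, injective j & forall x, r x = 0 <-> exists y, j y = x].
Proof.
move=> iK; have [Y [j [jI jP]]] := sub_modP (ker_submod r).
exists Y, j; split=> //; have rj x : r (j x) = 0 by apply/jP; exists x.
apply: iso_sym; apply: (@bij_iso _ _ (pcopair i j)).
  apply: linear_inj => -[x y] /= e.
  have x0 : x = 0 by have := congr1 r e; rewrite linearD iK rj addr0 linear0.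
  by move: e; rewrite x0 linear0 add0r => e; congr pair; apply: jI; rewrite e linear0.
move=> m; have [|y yE] := (jP (m - i (r m))).1; first by rewrite linearB iK subrr.
by exists (r m, y) => /=; rewrite yE addrC subrK.
Qed.

Lemma indec_idem M (p : {linear M -> M}) : indecomposable M ->
  (forall x, p (p x) = p x) -> (forall x, p x = 0) \/ (forall x, p x = x).
Proof.
move=> [_ ind] pp; have [X [j [jI jP]]] := sub_modP (im_submod p).
have pj y : p (j y) = j y by have [x <-] := (jP (j y)).2 (ex_intro _ y erefl); rewrite pp.
have [r rP] : exists r : {linear M -> X}, forall x, j (r x) = p x.
  apply: (@linear_choice M X (fun x y => j y = p x)).
  - by move=> x; apply/jP; exists x.
  - by move=> x y y' e e'; apply: jI; rewrite e e'.
  - by move=> a x x' y y' e e'; rewrite !linearP e e'.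
have jK : cancel j r by move=> y; apply: jI; rewrite rP pj.
have [Y [i [e iI iP]]] := retract_summand jK.
case: (ind _ _ e) => h; [left|right] => x; first by rewrite -rP (h (r x)) linear0.
have [|y yE] := (iP (x - p x)).1; first by rewrite linearB -rP jK subrr.
by move: yE; rewrite (h y) linear0 => /eqP; rewrite eq_sym subr_eq0 => /eqP.
Qed.

End LinearMaps.

(** * Finite length, Krull-Schmidt and projectives *)

Section FiniteLength.
Variable R : nzRingType.
Implicit Types M N X Y : lmodType R.

(* Finite length, in the form of a bounded function on submodules which is
   strictly increasing along proper inclusions. *)
Definition finite_length M : Prop :=
  exists (rk : (M -> Prop) -> nat) (b : nat), (forall U, (rk U <= b)%N) /\
    forall U V, is_submod U -> is_submod V -> (forall x, U x -> V x) ->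
      (rk V <= rk U)%N -> forall x, V x -> U x.

Lemma finite_length_inj M N (f : {linear M -> N}) :
  injective f -> finite_length N -> finite_length M.
Proof.
move=> fI [rk [b [rkb rkP]]].
pose im (U : M -> Prop) y := exists2 x, U x & f x = y.
have him U : is_submod U -> is_submod (im U).
  move=> hU; split; first by exists 0; [apply: submod0|rewrite linear0].
  move=> a _ _ [x Ux <-] [y Uy <-]; exists (a *: x + y); last by rewrite linearP.
  by case: hU => _; apply.
exists (rk \o im), b; split=> [U|U V hU hV UV h x Vx]; first exact: rkb.
suff [y Uy /fI <-//] : im U (f x).
apply: (rkP _ _ (him _ hU) (him _ hV) _ h (f x)); last by exists x.
by move=> _ [y Uy <-]; exists y => //; apply: UV.
Qed.

(** One potential, [rk (U n) + (b - rk (V n))], controls both chains: it grows whenever either of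
    them moves and is at most [b + b]. So both pause at the same index, as Fitting's lemma requires
    for kernels and images. *)
Lemma finite_length_stable M (U V : nat -> M -> Prop) : finite_length M ->
  (forall n, is_submod (U n)) -> (forall n, is_submod (V n)) ->
  (forall n x, U n x -> U n.+1 x) -> (forall n x, V n.+1 x -> V n x) ->
  exists n, (forall x, U n.+1 x -> U n x) /\ (forall x, V n x -> V n.+1 x).
Proof.
move=> [rk [b [rkb rkP]]] hU hV Ui Vi; apply: contrapT => h.
have Ule n : (rk (U n) <= rk (U n.+1))%N.
  rewrite leqNgt; apply/negP => lt; have := rkP _ _ (hU n) (hU n.+1) (Ui n) (ltnW lt).
  move=> le; suff e : U n.+1 = U n by rewrite e ltnn in lt.
  by apply/funext => x; apply/propext; split; [apply: le|apply: Ui].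
have Vle n : (rk (V n.+1) <= rk (V n))%N.
  rewrite leqNgt; apply/negP => lt; have := rkP _ _ (hV n.+1) (hV n) (Vi n) (ltnW lt).
  move=> le; suff e : V n.+1 = V n by rewrite e ltnn in lt.
  by apply/funext => x; apply/propext; split; [apply: Vi|apply: le].
have step n : (rk (U n) + (b - rk (V n)) < rk (U n.+1) + (b - rk (V n.+1)))%N.
  have le2 : (b - rk (V n) <= b - rk (V n.+1))%N by rewrite leq_sub2l.
  have [UU|UU] := ltnP (rk (U n)) (rk (U n.+1)); first by rewrite -addSn leq_add.
  have [VV|VV] := ltnP (rk (V n.+1)) (rk (V n)).
    by rewrite -addnS leq_add // ltn_sub2l // (leq_trans VV).
  case: h; exists n; split; first exact: (rkP _ _ (hU n) (hU n.+1) (Ui n) UU).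
  exact: (rkP _ _ (hV n.+1) (hV n) (Vi n) VV).
have grow n : (n <= rk (U n) + (b - rk (V n)))%N.
  by elim: n => // n IH; apply: leq_ltn_trans (step n).
have := leq_trans (grow (b + b).+1) (leq_add (rkb _) (leq_subr _ _)).
by rewrite ltnn.
Qed.

Lemma finite_length_max M (Q : (M -> Prop) -> Prop) U0 : finite_length M ->
  (forall U, Q U -> is_submod U) -> Q U0 ->
  exists U, [/\ Q U, forall x, U0 x -> U x &
    forall V, Q V -> (forall x, U x -> V x) -> forall x, V x -> U x].
Proof.
move=> [rk [b [rkb rkP]]] hQ.
(* Induction on the room left above [U0]. *)
have [n] := ubnP (b - rk U0)%N; elim: n U0 => // n IH U0 lt Q0.
have [max|] := pselect (forall V, Q V -> (forall x, U0 x -> V x) -> forall x, V x -> U0 x).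
  by exists U0; split.
move/existsNP=> [V /not_implyP[QV /not_implyP[UV nVU]]].
have rkUV : (rk U0 < rk V)%N.
  by rewrite ltnNge; apply/negP => le; apply: nVU; exact: (rkP _ _ (hQ _ Q0) (hQ _ QV) UV le).
have [|U [QU VU Umax]] := IH V _ QV.
  rewrite ltnS in lt; apply: leq_trans lt; rewrite ltn_sub2l //.
  exact: leq_trans rkUV (rkb _).
by exists U; split=> // x /UV /VU.
Qed.

Lemma fin_gen_finType M (I : finType) (v : I -> M) :
  (forall x, exists a : I -> R, x = \sum_i a i *: v i) -> fin_gen M.
Proof.
move=> h; exists #|I|, (v \o enum_val) => x; have [a ->] := h x.
exists (a \o enum_val); rewrite (reindex (@enum_val I predT)) //=.
by exists enum_rank => i _; rewrite ?enum_valK ?enum_rankK.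
Qed.

Lemma fin_gen_surj M N (f : {linear M -> N}) : surj f -> fin_gen M -> fin_gen N.
Proof.
move=> fS [n [v vP]]; exists n, (f \o v) => y; have [x <-] := fS y.
have [a ->] := vP x; exists a; rewrite linear_sum; apply: eq_bigr => i _.
by rewrite linearZ.
Qed.

Lemma fin_gen_prod M N : fin_gen M -> fin_gen N -> fin_gen (M * N)%type.
Proof.
move=> [m [v vP]] [n [w wP]].
apply: (@fin_gen_finType _ ('I_m + 'I_n)%type
  (fun i => match i with inl i => pinl M N (v i) | inr j => pinr M N (w j) end)) => x.
have [a aE] := vP x.1; have [b bE] := wP x.2.
exists (fun i => match i with inl i => a i | inr j => b j end).
rewrite big_sumType /= [LHS]pinlrE aE bE !linear_sum.
by congr (_ + _); apply: eq_bigr => i _; rewrite linearZ.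
Qed.

(** A maximal finitely generated submodule absorbs the line through any [x], so it is all of [M]. *)
Lemma finite_length_fin_gen M : finite_length M -> fin_gen M.
Proof.
move=> hM; pose Q (U : M -> Prop) := is_submod U /\ exists (n : nat) (v : 'I_n -> M),
  forall x, U x -> exists a : 'I_n -> R, x = \sum_i a i *: v i.
have Q0 : Q (fun x => x = 0).
  split; last by exists 0, (fun=> 0) => x ->; exists (fun=> 0); rewrite big_ord0.
  by split=> // a x y -> ->; rewrite scaler0 addr0.
have [|U [[hU [n [v vP]]] _ Umax]] := finite_length_max hM _ Q0; first by move=> U [].
exists n, v => x; apply: (vP).
apply: (Umax (fun y => exists u w, [/\ U u, exists a, w = a *: x & y = u + w])).
- split; first exact: add_submod (line_submod x).
  exists n.+1, (fun i => oapp v x (unlift ord0 i)) => _ [u [_ [Uu [c ->] ->]]].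
  have [a ->] := vP u Uu; exists (fun i => oapp a c (unlift ord0 i)).
  rewrite big_ord_recl unlift_none /= addrC; congr (_ + _).
  by apply: eq_bigr => i _; rewrite !liftK.
- by move=> u Uu; exists u, 0; split=> //; [exists 0; rewrite scale0r|rewrite addr0].
- by exists 0, x; split; [apply: submod0|exists 1; rewrite scale1r|rewrite add0r].
Qed.

Section Fitting.
Variables (M : lmodType R) (hM : finite_length M).
Implicit Type u : {linear M -> M}.

(* [lin_pow2 u n] is the [2 ^ n]-th power of [u]. *)
Fixpoint lin_pow2 (u : {linear M -> M}) n : {linear M -> M} :=
  if n is n'.+1 then lin_pow2 u n' \o lin_pow2 u n' else u.

Lemma lin_pow2_fix u n x : u x = x -> lin_pow2 u n x = x.
Proof. by move=> ux; elim: n => //= n IH; rewrite !IH. Qed.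

Lemma lin_pow2_absorb (T : Type) (f : M -> T) u n :
  (forall x, f (u x) = f x) -> forall x, f (lin_pow2 u n x) = f x.
Proof. by move=> h; elim: n => //= n IH x; rewrite !IH. Qed.

Lemma lin_pow2_ker u n x : u x = 0 -> lin_pow2 u n x = 0.
Proof. by move=> ux; elim: n => //= n IH; rewrite IH linear0. Qed.

Lemma lin_pow2_im u n x : exists y, lin_pow2 u n x = u y.
Proof. by elim: n x => [|n IH] x /=; [exists x|apply: IH]. Qed.

(** With exponents that double, comparing consecutive terms compares a power [v] of [u] with
    [v \o v]. *)
Lemma lin_pow2_stable u : exists n,
  (forall x, lin_pow2 u n (lin_pow2 u n x) = 0 -> lin_pow2 u n x = 0) /\
  (forall x, exists y, lin_pow2 u n (lin_pow2 u n y) = lin_pow2 u n x).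
Proof.
have [||n [hk hi]] := @finite_length_stable M (fun n x => lin_pow2 u n x = 0)
  (fun n y => exists x, lin_pow2 u n x = y) hM (fun n => ker_submod _) (fun n => im_submod _).
- by move=> n x /= ->; rewrite linear0.
- by move=> n _ /= [x <-]; exists (lin_pow2 u n x).
by exists n; split=> x; [apply: hk|apply: hi; exists x].
Qed.

Lemma surj_endo_inj (u : {linear M -> M}) : surj u -> injective u.
Proof.
move=> uS; have [n [hk _]] := lin_pow2_stable u.
have nS m : surj (lin_pow2 u m).
  by elim: m => //= m IH y; have [x <-] := IH y; have [z <-] := IH x; exists z.
apply: linear_inj => x ux; have [y xE] := nS n x.
by rewrite -xE; apply: hk; rewrite xE lin_pow2_ker.
Qed.

Lemma inj_endo_surj (u : {linear M -> M}) : injective u -> surj u.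
Proof.
move=> uI x; have [n [_ hi]] := lin_pow2_stable u.
have nI : injective (lin_pow2 u n) by elim: n {hi} => //= n IH; apply: inj_comp.
by have [y /nI <-] := hi x; have [z ->] := lin_pow2_im u n y; exists z.
Qed.

Hypothesis indM : indecomposable M.

(** For a stable power [v], M is the direct sum of im v and ker v. The projection [p] onto im v
    along ker v is an idempotent of an indecomposable module, hence zero (then v = 0) or the
    identity (then ker v = 0). *)
Lemma fitting (u : {linear M -> M}) :
  injective u \/ exists n, forall x, lin_pow2 u n x = 0.
Proof.
have [n [hk hi]] := lin_pow2_stable u; set v := lin_pow2 u n in hk hi *.
have [p pP] : exists p : {linear M -> M}, forall x,
    (exists z, p x = v z) /\ v (x - p x) = 0.
  apply: (@linear_choice _ M M (fun x y => (exists z, y = v z) /\ v (x - y) = 0)).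
  - by move=> x; have [y yE] := hi x; exists (v y); split; [exists y|rewrite linearB yE subrr].
  - move=> x _ _ [[y ->] e] [[y' ->] e']; apply/eqP; rewrite -subr_eq0 -linearB; apply/eqP/hk.
    have -> : v (y - y') = (x - v y') - (x - v y).
      by rewrite linearB opprB [RHS]addrC addrA subrK.
    by rewrite linearB e e' subrr.
  - move=> a x x' _ _ [[y ->] e] [[y' ->] e']; split; first by exists (a *: y + y'); rewrite linearP.
    by rewrite opprD addrACA -scalerN -scalerDr linearP e e' scaler0 addr0.
have pu x y : (exists z, y = v z) -> v (x - y) = 0 -> p x = y.
  move=> [z ->] e; have [[z' ->] e'] := pP x; apply/eqP; rewrite -subr_eq0 -linearB; apply/eqP/hk.
  have -> : v (z' - z) = (x - v z) - (x - v z').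
    by rewrite linearB opprB [RHS]addrC addrA subrK.
  by rewrite linearB e e' subrr.
have pp x : p (p x) = p x by apply: pu; [case: (pP x)|rewrite subrr linear0].
have [p0|p1] := indec_idem indM pp; [right|left].
  by exists n => x; have [_] := pP x; rewrite p0 subr0.
apply: linear_inj => x ux; rewrite -(p1 x); apply: pu; first by exists 0; rewrite linear0.
by rewrite subr0 lin_pow2_ker.
Qed.

(** Locality of the endomorphism ring; at finite length injective means invertible. *)
Lemma inj_add (u v w : {linear M -> M}) : injective w ->
  (forall x, w x = u x + v x) -> injective u \/ injective v.
Proof.
move=> wI wE; have [w' [_ w'K]] := bij_inv wI (inj_endo_surj wI).
have w'I : injective w' by exact: can_inj w'K.
have [h|[n h]] := fitting (w' \o u : {linear _ -> _}).
  by left=> x y e; apply: h; rewrite /= e.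
(* On ker v the nilpotent map [w' \o u] is the identity, so ker v = 0. *)
right; apply: linear_inj => x vx; rewrite -(h x); symmetry; apply: lin_pow2_fix => /=.
by apply: wI; rewrite w'K wE vx addr0.
Qed.

Lemma inj_sum (I : Type) (r : seq I) (g : I -> {linear M -> M}) (w : {linear M -> M}) :
  injective w -> (forall x, w x = \sum_(i <- r) g i x) -> exists i, injective (g i).
Proof.
elim: r w => [|i r IH] w wI wE.
  by case: indM => M0 _; case: M0 => x; apply: wI; rewrite !wE !big_nil.
have lv : linear (fun x => \sum_(i <- r) g i x).
  move=> a x y; rewrite scaler_sumr -big_split; apply: eq_bigr => j _; exact: linearP.
have [|h|h] := @inj_add (g i) (mk_linear lv) w wI; first by move=> x; rewrite wE big_cons.
  by exists i.
exact: IH h (fun=> erefl).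
Qed.

End Fitting.

Lemma retract_indec X M (i : {linear X -> M}) (r : {linear M -> X}) :
  cancel i r -> ~ is_zero X -> indecomposable M -> surj i.
Proof.
move=> iK X0 [_ indM] m; have [Y [j [e _ jP]]] := retract_summand iK.
have [//|Y0] := indM _ _ e.
have [|y yE] := (jP (m - i (r m))).1; first by rewrite linearB iK subrr.
exists (r m); move: yE; rewrite (Y0 y) linear0 => /eqP.
by rewrite eq_sym subr_eq0 => /eqP.
Qed.

Lemma inj_endo_retract X M (a : {linear X -> M}) (b : {linear M -> X}) : finite_length X ->
  injective (b \o a) -> exists b' : {linear M -> X}, cancel a b'.
Proof.
move=> hX h; have [c [cK _]] := bij_inv h (inj_endo_surj hX (u := b \o a) h).
by exists (c \o b : {linear _ -> _}).
Qed.

(** The identity of [Y] is the sum of the [b i \o a i], so by locality one of these is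
    invertible. *)
Lemma krull_schmidt Y (I : Type) (r : seq I) (X : I -> lmodType R)
    (a : forall i, {linear Y -> X i}) (b : forall i, {linear X i -> Y}) :
  finite_length Y -> indecomposable Y -> (forall x, x = \sum_(i <- r) b i (a i x)) ->
  exists (i : I) (b' : {linear X i -> Y}), cancel (a i) b'.
Proof.
move=> hY indY e.
have [||i h] := @inj_sum Y hY indY I r (fun i => b i \o a i) idfun; [exact: inj_id|exact: e|].
by exists i; apply: inj_endo_retract h.
Qed.

End FiniteLength.

(** * Projective modules through dual bases *)

Section Projectives.
Variable R : nzRingType.
Implicit Types M N X Y P : lmodType R.

Definition dual_basis M (I : finType) (m : I -> M) (phi : I -> {linear M -> R^o}) : Prop :=
  forall x, x = \sum_i (phi i x : R) *: m i.

Lemma comb_linear M (I : finType) (m : I -> M) :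
  linear (fun a : {ffun I -> R^o} => \sum_i (a i : R) *: m i).
Proof.
move=> c a b; rewrite scaler_sumr -big_split; apply: eq_bigr => i _.
by rewrite !ffunE scalerDl scalerA.
Qed.

Lemma dual_basis_fin_gen M (I : finType) (m : I -> M) phi :
  dual_basis m phi -> fin_gen M.
Proof. by move=> h; apply: (@fin_gen_finType _ M I m) => x; exists (phi^~ x). Qed.

Lemma dual_basis_projective M (I : finType) (m : I -> M) phi :
  dual_basis m phi -> projective M.
Proof.
move=> h X Y g f gS; have [x xP] := choice (fun i => gS (f (m i))).
have lh : linear (fun u => \sum_i (phi i u : R) *: x i).
  move=> c a b; rewrite scaler_sumr -big_split; apply: eq_bigr => i _.
  by rewrite linearP scalerDl scalerA.
exists (mk_linear lh) => u /=; rewrite [in RHS](h u) !linear_sum; apply: eq_bigr => i _.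
by rewrite !linearZ /= xP.
Qed.

Lemma projective_dual_basis P (I : finType) (m : I -> P) : projective P ->
  (forall x, exists a : I -> R, x = \sum_i a i *: m i) ->
  exists phi, dual_basis m phi.
Proof.
move=> hP gen; have := hP _ _ (mk_linear (comb_linear m)) idfun.
case=> [x|s sP]; first by have [a ->] := gen x; exists [ffun i => a i];
  apply: eq_bigr => i _; rewrite ffunE.
have lp i : linear (fun x => s x i : R^o) by move=> a x y; rewrite linearP !ffunE.
by exists (fun i => mk_linear (lp i)) => x; rewrite -[LHS]sP.
Qed.

Lemma ffun_dual_basis (I : finType) :
  exists (m : I -> {ffun I -> R^o}) phi, dual_basis m phi.
Proof.
have lp i : linear (fun x : {ffun I -> R^o} => x i : R^o) by move=> a x y; rewrite !ffunE.
exists (fun i => [ffun j => (i == j)%:R : R]), (fun i => mk_linear (lp i)) => x.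
apply/ffunP => j; rewrite sum_ffunE (bigD1 j) //= big1 => [|i ij].
  by rewrite addr0 !ffunE eqxx [RHS](mulr1 (x j : R)).
by rewrite !ffunE (negPf ij) [LHS](mulr0 (x i : R)).
Qed.

Lemma fin_gen_free_cover M : fin_gen M ->
  exists (F : lmodType R) (g : {linear F -> M}), [/\ fin_gen F, projective F & surj g].
Proof.
move=> [n [v vP]]; exists {ffun 'I_n -> R^o}, (mk_linear (comb_linear v)).
have [m [phi h]] := ffun_dual_basis 'I_n.
split; [exact: dual_basis_fin_gen h|exact: dual_basis_projective h|].
move=> x; have [a ->] := vP x; exists [ffun i => a i].
by apply: eq_bigr => i _; rewrite ffunE.
Qed.

(** [projective] lifts along surjections only, so [f] and [g] are first corestricted to the image of
    [f]. *)
Lemma projective_lift P X Y (f : {linear X -> Y}) (g : {linear P -> Y}) : projective P ->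
  (forall x, exists u, f u = g x) -> exists h : {linear P -> X}, forall x, f (h x) = g x.
Proof.
move=> prP im; have [K [j [jI jP]]] := sub_modP (im_submod f).
have [|||f' f'P] := @linear_choice _ X K (fun x y => j y = f x).
- by move=> x; apply/jP; exists x.
- by move=> x y y' e e'; apply: jI; rewrite e e'.
- by move=> a x x' y y' e e'; rewrite !linearP e e'.
have [|||g' g'P] := @linear_choice _ P K (fun x y => j y = g x).
- by move=> x; apply/jP; apply: im.
- by move=> x y y' e e'; apply: jI; rewrite e e'.
- by move=> a x x' y y' e e'; rewrite !linearP e e'.
have [|h hP] := prP _ _ f' g'; last by exists h => x; rewrite -f'P hP g'P.
move=> y; have [x xE] := (jP (j y)).2 (ex_intro _ y erefl).
by exists x; apply: jI; rewrite f'P.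
Qed.

Lemma projective_prod M N : projective M -> projective N -> projective (M * N)%type.
Proof.
move=> hM hN X Y g f gS.
have [h1 h1P] := hM _ _ g (f \o pinl M N) gS.
have [h2 h2P] := hN _ _ g (f \o pinr M N) gS.
by exists (pcopair h1 h2) => x; rewrite [in RHS](pinlrE x) !linearD /= h1P h2P.
Qed.

Lemma is_zero_fin_gen M : is_zero M -> fin_gen M.
Proof. by move=> M0; exists 0, (fun=> 0) => x; exists (fun=> 0); rewrite big_ord0; apply: M0. Qed.

Lemma is_zero_projective M : is_zero M -> projective M.
Proof. by move=> M0 X Y g f _; exists \0 => x; rewrite (M0 x) linear0 [RHS]linear0. Qed.

Lemma is_zero_prod M N : is_zero M -> is_zero N -> is_zero (M * N)%type.
Proof. by move=> M0 N0 [x y]; congr pair. Qed.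

Lemma zero_mod_is_zero : is_zero (zero_mod R).
Proof. by move=> x; apply/matrixP => i []. Qed.

End Projectives.

(** * Ideals generated by idempotents *)

(** A subspace of maximal dimension among those contained in [P] exhausts [P]: another vector would
    enlarge it. *)
Lemma vspace_of_pred (k : fieldType) (V : vectType k) (P : V -> Prop) :
  P 0 -> (forall c x y, P x -> P y -> P (c *: x + y)) ->
  exists W : {vspace V}, forall x, x \in W <-> P x.
Proof.
move=> P0 PP; pose Q n := `[< exists W : {vspace V}, \dim W = n /\ forall x, x \in W -> P x >].
have exQ : exists n, Q n.
  exists 0; apply/asboolP; exists 0%VS; split; first exact: dimv0.
  by move=> x; rewrite memv0 => /eqP ->.
have ubQ n : Q n -> (n <= \dim {:V})%N.
  by move=> /asboolP[W [<- _]]; apply: dimvS; apply: subvf.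
case: (ex_maxnP exQ ubQ) => n /asboolP[W [dW WP]] max.
exists W => x; split=> [|Px]; first exact: WP.
have [//|xW] := boolP (x \in W); exfalso.
have: Q (\dim (W + <[x]>)%VS).
  apply/asboolP; exists (W + <[x]>)%VS; split=> // _ /memv_addP[u uW [_ /vlineP[c ->] ->]].
  by rewrite addrC; apply: PP => //; apply: WP.
move/max; rewrite -dW => le.
have /eqP e : W == (W + <[x]>)%VS by rewrite eqEdim addvSl.
by case/negP: xW; rewrite e; apply: (subvP (addvSr W <[x]>)); apply: memv_line.
Qed.

(** The rank of a submodule is the dimension of its preimage in [V]; [M] itself needs no vector
    space structure. *)
Lemma vect_finite_length (k : fieldType) (V : vectType k) (R : nzRingType)
    (M : lmodType R) (g : V -> M) : surj g -> g 0 = 0 ->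
  (forall U, is_submod U -> forall c x y, U (g x) -> U (g y) -> U (g (c *: x + y))) ->
  finite_length M.
Proof.
move=> gS g0 gU; have : forall U, exists W : {vspace V}, is_submod U -> forall x, x \in W <-> U (g x).
  move=> U; have [hU|hU] := pselect (is_submod U); last by exists 0%VS.
  have [|c x y|W WP] := @vspace_of_pred k V (fun x => U (g x)).
  - by rewrite g0; apply: submod0.
  - exact: gU.
  - by exists W.
move=> /choice[W WP]; exists (fun U => \dim (W U)), (\dim {:V}); split.
  by move=> U; apply: dimvS; apply: subvf.
move=> U U' hU hU' UU' le y; have [x <-] := gS y.
move=> /(WP _ hU') xW; apply/(WP _ hU).
suff /eqP -> : W U == W U' by [].
rewrite eqEdim le andbT; apply/subvP => z /(WP _ hU) /UU'.
by move/(WP _ hU').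
Qed.

Lemma linear_ract (k : fieldType) (A : falgType k) (M N : right_mod A)
  (f : {linear M -> N}) m a : f (ract m a) = ract (f m) a.
Proof. exact: linearZ. Qed.

Section RightModules.
Variables (k : fieldType) (A : falgType k).
Implicit Types (M N : right_mod A) (a b e : A).

Lemma ractA M (m : M) a b : ract (ract m a) b = ract m (a * b).
Proof. exact: scalerA. Qed.
Lemma ract1 M (m : M) : ract m 1 = m.
Proof. exact: scale1r. Qed.
Lemma ractDl M (m m' : M) a : ract (m + m') a = ract m a + ract m' a.
Proof. exact: scalerDr. Qed.
Lemma ractDr M (m : M) a b : ract m (a + b) = ract m a + ract m b.
Proof. exact: scalerDl. Qed.
Lemma ractBr M (m : M) a b : ract m (a - b) = ract m a - ract m b.
Proof. exact: scalerBl. Qed.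

Lemma falg_finite_length M : fin_gen M -> finite_length M.
Proof.
move=> [n [v vP]].
apply: (@vect_finite_length k {ffun 'I_n -> A} _ M (fun x => \sum_i ract (v i) (x i))).
- by move=> x; have [a ->] := vP x; exists [ffun i => a i : A]; apply: eq_bigr => i _; rewrite ffunE.
- by rewrite big1 // => i _; rewrite ffunE [LHS]scale0r.
move=> U hU c x y Ux Uy.
have -> : \sum_i ract (v i) ((c *: x + y) i) =
  ract (\sum_i ract (v i) (x i)) c%:A + \sum_i ract (v i) (y i).
  rewrite /ract scaler_sumr -big_split; apply: eq_bigr => i _.
  rewrite /= scalerA -scalerDl !ffunE.
  by have -> : c *: x i = x i * c%:A by rewrite -scalerAr mulr1.
by case: hU => _; apply.
Qed.

Section PrincipalIdeal.
Variables (e : A) (he : idempotent e).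

Lemma in_eAP a : reflect (e * a = a) (in_eA e (a : (A^c)^o)).
Proof.
apply: (iffP memv_imgP) => [[u _ ->]|ea]; first by rewrite lfunE /= mulrA he.
by exists a; [exact: memvf|rewrite lfunE].
Qed.

Fact eA_val_linear : linear (fun x : eA e => \val x : reg_right A).
Proof. by []. Qed.
Definition eA_val : {linear eA e -> reg_right A} := mk_linear eA_val_linear.

Lemma eA_val_inj : injective eA_val. Proof. exact: val_inj. Qed.

Lemma eA_valE x : e * (eA_val x : A) = eA_val x.
Proof. by apply/in_eAP; apply: valP x. Qed.

Lemma eA_projP : exists g : {linear reg_right A -> eA e},
  forall a : A, eA_val (g a) = e * a.
Proof.
apply: (@linear_choice _ (reg_right A) (eA e) (fun a x => eA_val x = e * (a : A))).
- move=> a; have h : in_eA e (e * (a : A) : (A^c)^o) by apply/in_eAP; rewrite mulrA he.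
  by exists (exist (fun x => in_eA e x) _ h : eA_type e).
- by move=> a x y xa ya; apply: eA_val_inj; rewrite xa ya.
- move=> c a b x y xa yb; rewrite linearP xa yb.
  by rewrite [RHS]mulrDr mulrA.
Qed.

Definition eA_proj : {linear reg_right A -> eA e} := projT1 (cid eA_projP).
Lemma eA_projE (a : A) : eA_val (eA_proj a) = e * a.
Proof. exact: projT2 (cid eA_projP) a. Qed.

Lemma eA_valK : cancel eA_val eA_proj.
Proof. by move=> x; apply: eA_val_inj; rewrite eA_projE eA_valE. Qed.

Definition eA_gen : eA e := eA_proj (1 : A).
Lemma eA_genE : eA_val eA_gen = e. Proof. by rewrite eA_projE mulr1. Qed.

Lemma eA_val_ract x a : eA_val (ract x a) = (eA_val x : A) * a.
Proof. exact: linear_ract. Qed.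

Lemma eA_gen_ract x : ract eA_gen (eA_val x) = x.
Proof. by apply: eA_val_inj; rewrite eA_val_ract eA_genE eA_valE. Qed.

Lemma eA_gen_e : ract eA_gen e = eA_gen.
Proof. by apply: eA_val_inj; rewrite eA_val_ract eA_genE. Qed.

Lemma eA_homE M (f : {linear eA e -> M}) x : f x = ract (f eA_gen) (eA_val x).
Proof. by rewrite -linear_ract eA_gen_ract. Qed.

Lemma eA_hom_e M (f : {linear eA e -> M}) : ract (f eA_gen) e = f eA_gen.
Proof. by rewrite -linear_ract eA_gen_e. Qed.

Fact ract_linear M (m : M) : linear (fun a : reg_right A => ract m a).
Proof.
by move=> a x y; rewrite /ract scalerDl scalerA.
Qed.
Definition ract_map M (m : M) : {linear reg_right A -> M} := mk_linear (ract_linear m).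

(** No condition on [m] is required: the generator goes to [ract m e]. *)
Definition eA_hom M (m : M) : {linear eA e -> M} := ract_map m \o eA_val.

Lemma eA_hom_apply M (m : M) x : eA_hom m x = ract m (eA_val x : A). Proof. by []. Qed.

Lemma eA_dual_basis : @dual_basis _ (eA e) unit (fun=> eA_gen) (fun=> eA_val).
Proof.
by move=> x; rewrite (big_pred1 tt) => [|[]//]; rewrite -[LHS]eA_gen_ract.
Qed.

Lemma eA_fin_gen : fin_gen (eA e).
Proof. exact: dual_basis_fin_gen eA_dual_basis. Qed.

Lemma eA_projective : projective (eA e).
Proof. exact: dual_basis_projective eA_dual_basis. Qed.

Lemma eA_finite_length : finite_length (eA e).
Proof. exact: falg_finite_length eA_fin_gen. Qed.

End PrincipalIdeal.

Lemma reg_right_fin_gen : fin_gen (reg_right A).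
Proof.
exists 1, (fun=> (1 : A)) => x; exists (fun=> x); rewrite big_ord1.
by rewrite -[LHS](mul1r (x : A)).
Qed.

End RightModules.

Arguments eA_val {k A e}.
Arguments eA_val_inj {k A e}.

(** * Primitive right ideals are local; multiplicities in a basic algebra *)

Section LocalIdeals.
Variables (k : fieldType) (A : falgType k).
Implicit Types (M N : right_mod A) (a b e : A).

Lemma primitive_idem e : primitive_idempotent e -> idempotent e. Proof. by case. Qed.

Lemma primitive_split e g : primitive_idempotent e -> g * g = g -> e * g = g -> g * e = g ->
  g = 0 \/ g = e.
Proof.
move=> [he _ prim] gg eg ge.
have [|||||->|/eqP] := prim g (e - g); [by []|..].
- by rewrite /idempotent mulrBl !mulrBr he eg ge gg subrr subr0.
- by rewrite mulrBr ge gg subrr.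
- by rewrite mulrBl eg gg subrr.
- by rewrite addrC subrK.
- by left.
- by rewrite subr_eq0 => /eqP->; right.
Qed.

(** The projection attached to a decomposition is left multiplication by an idempotent [a] of eAe,
    and primitivity leaves a = 0 or a = e. *)
Lemma primitive_indec e : primitive_idempotent e -> indecomposable (eA e).
Proof.
move=> pe; have [he e0 _] := pe; split.
  by move=> h; move/eqP: e0; apply; rewrite -(eA_genE he) (h (eA_gen he)) linear0.
move=> X Y [f [g [fK gK]]]; set x0 := eA_gen he.
pose p := g \o (pinl X Y \o (pfst X Y \o f)) : {linear eA e -> eA e}.
have pp x : p (p x) = p x by rewrite /p /= gK.
set a : A := eA_val (p x0).
have pE x : eA_val (p x) = a * eA_val x by rewrite (eA_homE he p) eA_val_ract.
have ae : a * e = a by rewrite -[X in _ * X](eA_genE he) -pE.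
have aa : a * a = a by rewrite -[X in _ * X = _]/(eA_val (p x0)) -pE pp.
have [a0|ae'] := primitive_split pe aa (eA_valE he _) ae; [left|right].
  move=> x; have : p (g (x, 0)) = 0 by apply: eA_val_inj; rewrite pE a0 mul0r linear0.
  rewrite /p /= gK /= => /(congr1 f); rewrite gK linear0 => e1.
  by move: (congr1 fst e1).
move=> y; have : p (g (0, y)) = g (0, y) by apply: eA_val_inj; rewrite pE ae' (eA_valE he).
rewrite /p /= gK /= => /(congr1 f); rewrite !gK => e1.
by move: (congr1 snd e1).
Qed.

Section Primitive.
Variables (e : A) (pe : primitive_idempotent e).
Let he := primitive_idem pe.
Let x0 := eA_gen he.

Lemma submod_ract M (U : M -> Prop) m a : is_submod U -> U m -> U (ract m a).
Proof. by move=> hU; apply: submodZ. Qed.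

Lemma eA_submod_full (U : eA e -> Prop) : is_submod U -> U x0 -> forall x, U x.
Proof.
by move=> hU Ux0 x; rewrite -(eA_gen_ract he x); apply: submod_ract.
Qed.

(** If the generator is u + v, the endomorphisms given by [u] and [v] add up to the identity; by
    locality one of them is onto, and its image lies in [U] or [V]. *)
Lemma eA_proper_add (U V : eA e -> Prop) u v : is_submod U -> is_submod V ->
  U u -> V v -> x0 = u + v -> U x0 \/ V x0.
Proof.
move=> hU hV Uu Vv x0E.
have [||h|h] := @inj_add _ _ (eA_finite_length he) (primitive_indec pe)
  (eA_hom e u) (eA_hom e v) idfun.
- exact: inj_id.
- by move=> x; rewrite /= -ractDl -x0E eA_gen_ract.
- left; have [y <-] := inj_endo_surj (eA_finite_length he) h x0; exact: submod_ract.
- right; have [y <-] := inj_endo_surj (eA_finite_length he) h x0; exact: submod_ract.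
Qed.

Lemma submod_max M (U0 : M -> Prop) (m : M) : finite_length M -> is_submod U0 -> ~ U0 m ->
  exists U, [/\ is_submod U, ~ U m, forall x, U0 x -> U x &
   forall V, is_submod V -> (forall x, U x -> V x) -> (exists2 x, V x & ~ U x) -> V m].
Proof.
move=> hM hU0 U0m.
have [U [sU Um]|//|U [[hU Um] U0U Umax]] :=
  @finite_length_max _ M (fun U => is_submod U /\ ~ U m) U0 hM; first by [].
exists U; split=> // V hV UV [x Vx nUx]; apply: contrapT => nVm.
by apply: nUx; apply: (Umax V).
Qed.

Lemma zero_submod M : is_submod (fun x : M => x = 0).
Proof. by split=> // a x y -> ->; rewrite scaler0 addr0. Qed.

(** A submodule maximal among those avoiding the generator is a maximal submodule. *)
Lemma radical_proper : ~ radical x0.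
Proof.
have [|U [hU Ux0 _ Umax]] := submod_max (eA_finite_length he) (zero_submod (eA e)) (m := x0).
  by move=> x00; case: pe => _ /eqP + _; apply; rewrite -(eA_genE he) -/x0 x00 linear0.
move=> rad; apply: (Ux0); apply: (rad); split=> //; first by exists x0.
move=> V hV UV; have [h|/existsNP[x /not_implyP[Vx nUx]]] := pselect (forall x, V x -> U x).
  by left.
by right; apply: eA_submod_full => //; apply: Umax => //; exists x.
Qed.

(** A maximal submodule not containing [U] would together with [U] span eA, against
    [eA_proper_add]. *)
Lemma proper_radical (U : eA e -> Prop) : is_submod U -> ~ U x0 ->
  forall x, U x -> radical x.
Proof.
move=> hU Ux0 x Ux W [hW [y nWy] Wmax]; apply: contrapT => nWx.
have [| h | h] := Wmax _ (add_submod hU hW).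
- by move=> z Wz; exists 0, z; split=> //; [apply: submod0|rewrite add0r].
- by apply: nWx; apply: h; exists x, 0; split=> //; [apply: submod0|rewrite addr0].
- have [u [v [Uu Vv x0E]]] := h x0.
  have [//|Wx0] := eA_proper_add hU hW Uu Vv x0E.
  by apply: nWy; apply: eA_submod_full.
Qed.

Section Top.
Variables (S : right_mod A) (p : {linear eA e -> S}).
Hypotheses (pS : surj p) (pP : forall x, p x = 0 <-> radical x).

Lemma top_gen_neq0 : p x0 <> 0. Proof. by move/pP; apply: radical_proper. Qed.

Lemma top_genP s : exists a, s = ract (p x0) a.
Proof. by have [x <-] := pS s; exists (eA_val x); rewrite -(eA_homE he p). Qed.

Lemma eA_proper_ker (U : eA e -> Prop) : is_submod U -> ~ U x0 -> forall x, U x -> p x = 0.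
Proof. by move=> hU nU x Ux; apply/pP; apply: proper_radical Ux. Qed.

Lemma top_simple (V : S -> Prop) : is_submod V -> ~ V (p x0) -> forall s, V s -> s = 0.
Proof.
move=> hV nV s; have [x <-] := pS s.
exact: (eA_proper_ker (preim_submod p hV)).
Qed.

Lemma eA_endo_inj (u : {linear eA e -> eA e}) : p (u x0) <> 0 -> injective u.
Proof.
move=> h; apply: (surj_endo_inj (eA_finite_length he)) => y.
apply: (eA_submod_full (im_submod u)); apply: contrapT => n.
by apply: h; apply: (eA_proper_ker (im_submod u)) => //; exists x0.
Qed.

End Top.
End Primitive.

Section Basic.
Variables (n : nat) (f : 'I_n -> A).
Hypotheses (fprim : forall i, primitive_idempotent (f i)) (fsum : \sum_i f i = 1)
  (fdist : forall i j, iso_mod (eA (f i)) (eA (f j)) -> i = j).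
Let hf i := primitive_idem (fprim i).
Variables (Y : right_mod A) (Yfl : finite_length Y) (Yind : indecomposable Y).

Lemma reg_sum (a : reg_right A) : a = \sum_i eA_val (eA_proj (hf i) a).
Proof.
rewrite -[LHS](mul1r (a : A)) -fsum mulr_suml.
by apply: eq_bigr => i _; rewrite eA_projE.
Qed.

Lemma retract_reg_iso i (a : {linear Y -> eA (f i)}) (b : {linear eA (f i) -> Y}) :
  cancel a b -> iso_mod Y (eA (f i)).
Proof.
move=> aK; apply: (@bij_iso _ _ _ a); first exact: can_inj aK.
by apply: retract_indec aK _ _; [case: Yind|apply: primitive_indec].
Qed.

Lemma indec_summand_reg (a : {linear Y -> reg_right A}) (b : {linear reg_right A -> Y}) :
  cancel a b -> exists i, iso_mod Y (eA (f i)).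
Proof.
move=> aK; have [|i [b' b'K]] := @krull_schmidt _ Y _ (index_enum 'I_n) (fun i => eA (f i))
  (fun i => eA_proj (hf i) \o a) (fun i => b \o (eA_val (e := f i))) Yfl Yind.
  by move=> x; rewrite -[LHS]aK [in LHS](reg_sum (a x)) linear_sum.
by exists i; apply: retract_reg_iso b'K.
Qed.

(* Two orthogonal embeddings would make [Y] occur twice among the [eA (f i)]. *)
Lemma reg_multiplicity_one (a1 a2 : {linear Y -> reg_right A})
    (b1 b2 : {linear reg_right A -> Y}) :
  cancel a1 b1 -> cancel a2 b2 -> (forall x, b2 (a1 x) = 0) -> False.
Proof.
move=> a1K a2K b2a1.
have comp (a : {linear Y -> reg_right A}) (b : {linear reg_right A -> Y}) : cancel a b ->
    exists i, injective (b \o eA_val \o (eA_proj (hf i) \o a)).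
  move=> aK; apply: (@inj_sum _ Y Yfl Yind _ (index_enum 'I_n)
    (fun i => b \o (eA_val (e := f i)) \o (eA_proj (hf i) \o a)) idfun); first exact: inj_id.
  by move=> x; rewrite -[LHS]aK [in LHS](reg_sum (a x)) linear_sum.
have isoI (i : 'I_n) (u : {linear Y -> eA (f i)}) (v : {linear eA (f i) -> Y}) :
    injective (v \o u) -> iso_mod Y (eA (f i)) /\ surj u.
  move=> /(inj_endo_retract Yfl)[v' uK]; split; first exact: retract_reg_iso uK.
  by apply: retract_indec uK _ _; [case: Yind|apply: primitive_indec].
have uniq i j : iso_mod Y (eA (f i)) -> iso_mod Y (eA (f j)) -> i = j.
  by move=> hi hj; apply: fdist; apply: iso_trans hj; apply: iso_sym.
have [i inj1] := comp _ _ a1K; have [j inj2] := comp _ _ a2K.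
have [iso1 surj1] := isoI _ _ _ inj1; have [iso2 surj2] := isoI _ _ _ inj2.
have ij := uniq _ _ iso1 iso2; subst j.
(* The part of [b2 \o a1] that passes through the common index [i] is already invertible. Since
   [b2 \o a1] vanishes, the remaining parts sum to [- w], so one of them is injective and produces a
   second index. *)
pose w := (b2 \o eA_val \o (eA_proj (hf i) \o a1)) : {linear Y -> Y}.
have wI : injective w.
  apply: (surj_endo_inj Yfl) => y; have [z <-] := inj_endo_surj Yfl inj2 y.
  by have [t tE] := surj1 (eA_proj (hf i) (a2 z)); exists t; rewrite /w /= in tE *; rewrite tE.
(* [inj_sum] does not say that its index lies in the list; the value [\0] at [i] excludes
   [l = i]. *)
have [||l lI] := @inj_sum _ Y Yfl Yind 'I_n [seq j <- index_enum 'I_n | j != i]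
  (fun j => if j == i then (\0 : {linear Y -> Y}) else
    (\- (b2 \o eA_val (e := f j) \o (eA_proj (hf j) \o a1)) : {linear Y -> Y})) w.
- exact: wI.
- move=> x; have := b2a1 x; rewrite [in X in X -> _](reg_sum (a1 x)) linear_sum (bigD1 i) //=.
  move/eqP; rewrite addr_eq0 => /eqP ->; rewrite big_filter -sumrN.
  by apply: eq_bigr => j /negPf ->.
case: eqP lI => [_ h|/eqP li h].
  by case: Yind => Y0 _; apply: Y0 => x; apply: h.
have /isoI[isol _] : injective (b2 \o eA_val (e := f l) \o (eA_proj (hf l) \o a1)).
  by move=> x y xy; apply: h; apply: (congr1 -%R xy).
by case/eqP: li; apply: uniq isol iso1.
Qed.

End Basic.
End LocalIdeals.

(** * Vanishing of first extension groups *)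

Section ChainComplex.
Variables (R : nzRingType) (P : nat -> lmodType R) (d : forall n, {linear P n.+1 -> P n}).
Hypothesis dd : forall n x, d n (d n.+1 x) = 0.

Definition chain_obj (i : int) : lmodType R :=
  match i with Posz 0 => P 0 | Posz _ => zero_mod R | Negz n => P n.+1 end.

(** The negative cases are split so that [chain_obj (i + 1)] computes in each of them. *)
Definition chain_diff (i : int) : {linear chain_obj i -> chain_obj (i + 1)} :=
  match i with
  | Posz n => \0
  | Negz 0 => d 0
  | Negz 1 => d 1
  | Negz n.+2 => d n.+2
  end.

Fact chain_diffK i x : chain_diff (i + 1) (chain_diff i x) = 0.
Proof.
by case: i x => [n|[|[|[|n]]]] x; rewrite ?linear0 //; apply: dd.
Qed.

Definition chain_complex : complex R := Complex chain_diffK.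

Lemma chain_resolution (M : lmodType R) (p : {linear P 0 -> M}) :
  (forall n, fin_gen (P n) /\ projective (P n)) -> surj p ->
  (forall x, p x = 0 <-> exists y, d 0 y = x) ->
  (forall n x, d n x = 0 <-> exists y, d n.+1 y = x) ->
  proj_resolution (P := chain_complex) p.
Proof.
move=> hP pS p0 dn; split=> //.
- move=> [[|n]|n]; try exact: hP.
  by split; [apply: is_zero_fin_gen|apply: is_zero_projective]; apply: zero_mod_is_zero.
- by move=> [[|n]|n] // _; apply: zero_mod_is_zero.
- by move=> [n|[|[|[|n]]]] // _ x; apply: dn.
Qed.

End ChainComplex.

Section Ext1.
Variable R : nzRingType.
Hypothesis Rfl : forall M : lmodType R, fin_gen M -> finite_length M.
Implicit Types (M N P K : lmodType R).

(** Finite length makes the kernel finitely generated, so a resolution by finitely generated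
    projectives can always be continued. *)
Lemma kernel_cover P M (p : {linear P -> M}) : fin_gen P ->
  exists (F : lmodType R) (g : {linear F -> P}),
    [/\ fin_gen F, projective F & forall x, p x = 0 <-> exists y, g y = x].
Proof.
move=> /Rfl hP; have [K [j [jI jP]]] := sub_modP (ker_submod p).
have [F [g [fgF prF gS]]] := fin_gen_free_cover
  (finite_length_fin_gen (finite_length_inj jI hP)).
exists F, (j \o g); split=> // x; split=> [/jP[y <-]|[y <-]].
  by have [z <-] := gS y; exists z.
by apply/jP; exists (g y).
Qed.

(** The state of the recursion that builds a resolution: the last differential, whose kernel is
    covered next. *)
Record fg_map := FgMap {
  fg_src : lmodType R; fg_tgt : lmodType R; fg_mor : {linear fg_src -> fg_tgt};
  fg_srcP : fin_gen fg_src /\ projective fg_src }.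

(** [Ext1_zero] speaks about complete resolutions, so one that begins with [p] is built. Its degree
    -1 term maps onto [K], and [f] composed with that map is a cocycle. *)
Lemma Ext1_extend M N P K (p : {linear P -> M}) (j : {linear K -> P}) :
  Ext1_zero M N -> fin_gen P -> projective P -> surj p ->
  injective j -> (forall x, p x = 0 <-> exists y, j y = x) ->
  forall f : {linear K -> N}, exists g : {linear P -> N}, forall x, f x = g (j x).
Proof.
move=> ext fgP prP pS jI jP f.
have next (s : fg_map) : {t : fg_map & {g : {linear fg_src t -> fg_src s} |
    forall x, fg_mor s x = 0 <-> exists y, g y = x}}.
  have /cid[F /cid[g [fgF prF gP]]] := kernel_cover (fg_mor s) (fg_srcP s).1.
  by exists (FgMap g (conj fgF prF)), g.
pose st n := iter n (fun s => FgMap (sval (projT2 (next s))) (fg_srcP (projT1 (next s))))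
  (FgMap p (conj fgP prP)).
pose d n : {linear fg_src (st n.+1) -> fg_src (st n)} := fg_mor (st n.+1).
have dP n x : fg_mor (st n) x = 0 <-> exists y, d n y = x := svalP (projT2 (next (st n))) x.
have dd n x : d n (d n.+1 x) = 0 by apply/(dP n.+1); exists x.
have res := @chain_resolution R (fun n => fg_src (st n)) d dd M p
  (fun n => fg_srcP (st n)) pS (dP 0) (fun n => dP n.+1).
have jd y : exists x, j x = d 0 y by apply/jP/(dP 0); exists y.
have [f' f'P] : exists f' : {linear fg_src (st 1) -> N}, forall y x, j x = d 0 y -> f' y = f x.
  apply: (@linear_choice _ (fg_src (st 1)) N (fun y z => forall x, j x = d 0 y -> z = f x)).
  - by move=> y; have [x xE] := jd y; exists (f x) => x'; rewrite -xE => /jI ->.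
  - by move=> y z z' h h'; have [x xE] := jd y; rewrite (h x xE) (h' x xE).
  - move=> a y y' z z' h h' x xE; have [u uE] := jd y; have [v vE] := jd y'.
    rewrite (h u uE) (h' v vE) -linearP; congr (f _).
    by apply: jI; rewrite xE !linearP uE vE.
have [x|g gP] := ext _ _ res f'.
  by rewrite (f'P _ 0) ?linear0 //; symmetry; apply: (dd 0 x).
exists g => x; have [y yE] := (dP 0 (j x)).1 ((jP _).2 (ex_intro _ x erefl)).
by rewrite -(f'P y x (esym yE)) gP -yE.
Qed.

(** Lifts [a], [b] compare an arbitrary resolution with [P]. The cocycle, transported to [K] along
    [b], extends to [g]; the defect [x - b (a x)] is a boundary, on which the cocycle itself defines
    the correction [t]. *)
Lemma Ext1_of_extend M N P K (p : {linear P -> M}) (j : {linear K -> P}) :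
  projective P -> surj p -> (forall x, p x = 0 <-> exists y, j y = x) ->
  (forall f : {linear K -> N}, exists g : {linear P -> N}, forall x, f x = g (j x)) ->
  Ext1_zero M N.
Proof.
move=> prP pS jP ext Q eps [Qpr _ epsS eps0 Qex] phi phi0.
have [a aP] := (Qpr (Posz 0)).2 _ _ p eps pS.
have [b bP] := prP _ _ eps p epsS.
have phiE w w' : diff Q (Negz 0) w = diff Q (Negz 0) w' -> phi w = phi w'.
  move=> e; apply/eqP; rewrite -subr_eq0 -linearB.
  have [|v vE] := (Qex (Negz 1) erefl (w - w')).1; first by rewrite linearB; apply/eqP; rewrite subr_eq0 e.
  by rewrite -vE phi0.
have [|||f fP] := @linear_choice _ K N
  (fun x z => exists2 w, diff Q (Negz 0) w = b (j x) & z = phi w).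
  - move=> x; have [|w wE] := (eps0 (b (j x))).1; first by rewrite bP; apply/jP; exists x.
    by exists (phi w), w.
  - by move=> x y y' [w wE ->] [w' w'E ->]; apply: phiE; rewrite wE w'E.
  - by move=> c x x' y y' [w wE ->] [w' w'E ->]; exists (c *: w + w'); rewrite !linearP ?wE ?w'E.
have [g gP] := ext f.
have [|||t tP] := @linear_choice _ (Q (Posz 0)) N
  (fun x z => exists2 w, diff Q (Negz 0) w = x - b (a x) & z = phi w).
  - move=> x; have [|w wE] := (eps0 (x - b (a x))).1; first by rewrite linearB bP aP subrr.
    by exists (phi w), w.
  - by move=> x y y' [w wE ->] [w' w'E ->]; apply: phiE; rewrite wE w'E.
  - move=> c x x' y y' [w wE ->] [w' w'E ->]; exists (c *: w + w'); last by rewrite linearP.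
    by rewrite linearP wE w'E (linearP a) (linearP b) scalerBr opprD addrACA.
exists ((g \o a) \+ t) => v /=.
have [w' w'E ->] := tP (diff Q (Negz 0) v).
have [|z zE] := (jP (a (diff Q (Negz 0) v))).1; first by rewrite aP; apply/eps0; exists v.
rewrite -zE -gP; have [w wE ->] := fP z.
rewrite -linearD; apply: phiE; rewrite linearD wE w'E zE.
have sub (x y : Q (Posz 0)) : x = y + (x - y) by rewrite addrC subrK.
exact: sub.
Qed.

End Ext1.

(** * The top of a primitive right ideal *)

Section SimpleTop.
Variables (k : fieldType) (A : falgType k) (e : A).
Hypothesis pe : primitive_idempotent e.
Let he := primitive_idem pe.
Let x0 := eA_gen he.
Variables (S : right_mod A) (p : {linear eA e -> S}).
Hypotheses (pS : surj p) (pP : forall x, p x = 0 <-> radical x).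

(** If y = x(1-e) were outside the radical it would generate eA, so [a |-> y a] would be a split
    surjection A -> eA that vanishes on eA because y e = 0. Then eA would occur twice in A. *)
Lemma top_annihilated : basic_algebra A -> forall s : S, ract s (1 - e) = 0.
Proof.
move=> [n [f [fprim _ fsum fdist]]] s; have [x <-] := pS s.
rewrite -linear_ract; set y := ract x (1 - e); apply: contrapT => py.
have [a x0E] : exists a : A, x0 = ract y a.
  apply: contrapT => h; apply: py.
  apply: (eA_proper_ker pP (line_submod y)) => [[a aE]|]; first by apply: h; exists a.
  by exists 1; rewrite scale1r.
set v : A := eA_val y.
have va : v * a = e by rewrite -(eA_genE he) -/x0 x0E eA_val_ract.
have v1e : v * (1 - e) = v.
  rewrite /v /y eA_val_ract -mulrA; congr (_ * _).
  by rewrite mulrBr mulr1 mulrBl mul1r he subrr subr0.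
have ve : v * e = 0 by rewrite -v1e -mulrA mulrBl mul1r he subrr mulr0.
apply: (@reg_multiplicity_one _ _ n f fprim fsum fdist (eA e) (eA_finite_length he)
  (primitive_indec pe) eA_val (eA_hom e ((1 - e) * a : reg_right A)) (eA_proj he) (ract_map y)).
- exact: eA_valK.
- move=> t; apply: eA_val_inj; rewrite eA_val_ract -/v.
  by rewrite -[RHS](eA_valE he) [LHS]mulrA mulrA v1e va.
- move=> t; apply: eA_val_inj; rewrite eA_val_ract -/v linear0.
  by rewrite -(eA_valE he t) mulrA ve mul0r.
Qed.

(** [K] is the radical of eA. If [V] misses part of it, a maximal submodule [U] of [K] above [V] has
    quotient S; the resulting nonzero map [g] from [K] to S extends to eA, yet any such extension
    kills [K]. *)
Lemma radical_generated (V : eA e -> Prop) : Ext1_zero S S -> is_submod V ->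
  (forall r, p r = 0 -> V (ract r (1 - e))) -> forall r, p r = 0 -> V r.
Proof.
move=> ext hV VR; have [K [j [jI jP]]] := sub_modP (ker_submod p).
suff full (x : K) : V (j x) by move=> r /jP[x <-].
apply: contrapT => nVx.
have Kfl : finite_length K by apply: finite_length_inj jI (eA_finite_length he).
have pj y : p (j y) = 0 by apply/jP; exists y.
pose Q (U : K -> Prop) := is_submod U /\ exists x, ~ U x.
have [U [hU _]||U [[hU [z nUz]] VU Umax]] := @finite_length_max _ K Q (fun x => V (j x)) Kfl.
- by [].
- by split; [apply: preim_submod|exists x].
(* [U] contains z(1-e), so z e stays outside and generates [K] modulo [U]. *)
set y := ract z e.
have nUy : ~ U y.
  move=> Uy; apply: nUz.
  have -> : z = y + ract z (1 - e) by rewrite -ractDr addrC subrK ract1.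
  by apply: submodD => //; apply: VU; rewrite linear_ract; apply: VR.
have Uy s : exists a, U (s - ract y a).
  apply: contrapT => h; apply: nUy.
  apply: (Umax (fun s => exists u v, [/\ U u, exists a, v = a *: y & s = u + v])).
  - split; first exact: add_submod hU (line_submod y).
    exists s => -[u [_ [Uu [a ->] sE]]]; apply: h; exists a.
    by rewrite sE /ract addrK.
  - by move=> u Uu; exists u, 0; split=> //; [exists 0; rewrite scale0r|rewrite addr0].
  - by exists 0, y; split; [apply: submod0|exists 1; rewrite scale1r|rewrite add0r].
(* This makes [y a |-> p (x0 a)] well defined modulo [U]: the [t] in eA with y t in [U] form a
   proper submodule, as y e = y. *)
have annU a : U (ract y a) -> p (ract x0 a) = 0.
  move=> Ua; pose W (t : eA e) := U (eA_hom e y t).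
  have hW : is_submod W by apply: (preim_submod (eA_hom e y)).
  apply: (eA_proper_ker pP hW); rewrite /W eA_hom_apply.
    by rewrite (eA_genE he) ractA he.
  by rewrite eA_val_ract (eA_genE he) /y ractA mulrA he -ractA.
have [|||g gP] := @linear_choice _ K S (fun s t => exists2 a, t = p (ract x0 a) & U (s - ract y a)).
- by move=> s; have [a Ua] := Uy s; exists (p (ract x0 a)), a.
- move=> s t t' [a -> Ua] [b -> Ub]; apply/eqP; rewrite -subr_eq0 -linearB -ractBr; apply/eqP/annU.
  rewrite ractBr; have -> : ract y a - ract y b = (s - ract y b) - (s - ract y a).
    by rewrite opprB [RHS]addrC addrA subrK.
  exact: submodB.
- move=> c s s' t t' [a -> Ua] [b -> Ub]; exists (a * (c : A) + b).
    by rewrite ractDr -ractA linearD (linear_ract p (ract x0 a)).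
  rewrite ractDr -ractA opprD addrACA.
  by rewrite /ract -scalerBr; case: hU => _; apply.
have [q qP] := Ext1_extend (@falg_finite_length _ A) ext (eA_fin_gen he)
  (eA_projective he) pS jI jP g.
(* Otherwise q r' = p x0 for some r' in the radical, and q x0 = q (r' a) for some [a]. Then x0 - r'
   a lies in the proper submodule ker q, hence in the radical, and so would x0. *)
have q0 r : p r = 0 -> q r = 0.
  move=> pr0; apply: contrapT => qr.
  have hV' : is_submod (fun s => exists2 r, p r = 0 & q r = s).
    split; first by exists 0; rewrite linear0.
    move=> a _ _ [t t0 <-] [t' t'0 <-]; exists (a *: t + t'); rewrite linearP //.
    by rewrite t0 t'0 scaler0 addr0.
  case: (pselect (exists2 r, p r = 0 & q r = p x0)) => [[r' pr' qr']|h]; last first.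
    by apply: qr; apply: (top_simple pS pP hV' h); exists r.
  have [a aE] := top_genP pe pS (q x0).
  have : p (x0 - ract r' a) = 0.
    apply: (eA_proper_ker pP (ker_submod q)) => [qx0|].
      by apply: qr; rewrite (eA_homE he q) -/x0 qx0 /ract scaler0.
    by rewrite linearB linear_ract qr' aE subrr.
  rewrite linearB linear_ract pr' /ract scaler0 subr0.
  exact: (top_gen_neq0 pP).
have [a gy Ua] := gP y.
have := annU (1 - a); rewrite ractBr ract1 => /(_ Ua).
rewrite ractBr ract1 linearB -gy qP q0 // subr0.
exact: (top_gen_neq0 pP).
Qed.

End SimpleTop.

(** * Linear functionals and the dual of the top *)

Section Functionals.
Variables (k : fieldType) (M : zmodType) (sc : k -> M -> M).

(** The action [sc] is a parameter because k acts on right and left modules only through [c%:A]. *)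
Definition functional (f : M -> k) : Prop :=
  (forall x y, f (x + y) = f x + f y) /\ (forall c x, f (sc c x) = c * f x).

Lemma functional0 f : functional f -> f 0 = 0.
Proof. by case=> fD _; apply: (addrI (f 0)); rewrite -fD !addr0. Qed.

Lemma functionalB f x y : functional f -> f (x - y) = f x - f y.
Proof. by case=> fD _; apply: (addIr (f y)); rewrite -fD !subrK. Qed.

Lemma functional_span n (g : 'I_n -> M -> k) f : (forall i, functional (g i)) ->
  functional f -> (forall x, (forall i, g i x = 0) -> f x = 0) ->
  exists c : 'I_n -> k, forall x, f x = \sum_i c i * g i x.
Proof.
elim: n g f => [|n IH] g f hg hf ker.
  by exists (fun=> 0) => x; rewrite big_ord0; apply: ker; case.
have [c0 c0P] : exists c0, forall x, (forall i, g (lift ord0 i) x = 0) ->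
    f x - c0 * g ord0 x = 0.
  have [[x0 x0P nz]|h] := pselect (exists2 x0, forall i, g (lift ord0 i) x0 = 0 & g ord0 x0 <> 0).
    (* The coefficient of [g ord0] is read off at a point where all the other [g i] vanish. *)
    exists (f x0 / g ord0 x0) => x xP.
    have : f (x - sc (g ord0 x / g ord0 x0) x0) = 0.
      apply: ker => i; have [j ->|->] := unliftP ord0 i; rewrite functionalB // (hg _).2.
        by rewrite xP x0P mulr0 subr0.
      by rewrite divfK ?subrr //; apply/eqP.
    rewrite functionalB // hf.2 => h; rewrite -[RHS]h; congr (_ - _).
    by rewrite mulrAC -mulrA mulrC.
  exists 0 => x xP; rewrite mul0r subr0; apply: ker => i.
  have [j ->//|->] := unliftP ord0 i; apply: contrapT => nz.
  by apply: h; exists x.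
have [|||c cP] := IH (fun i => g (lift ord0 i)) (fun x => f x - c0 * g ord0 x).
- by move=> i; apply: hg.
- split=> [x y|c x]; first by rewrite hf.1 (hg _).1 mulrDr opprD addrACA.
  by rewrite hf.2 (hg _).2 mulrBr mulrCA.
- exact: c0P.
exists (fun i => oapp c c0 (unlift ord0 i)) => x.
rewrite big_ord_recl unlift_none /= addrC; apply/eqP; rewrite -subr_eq cP; apply/eqP.
by apply: eq_bigr => i _; rewrite liftK.
Qed.

End Functionals.

Section Extension.
Variables (k : fieldType) (A : falgType k) (M : right_mod A).
Let sc (c : k) (m : M) := ract m c%:A.

Local Lemma scA c d m : sc c (sc d m) = sc (c * d) m.
Proof. by rewrite /sc ractA -scalerAl mul1r scalerA mulrC. Qed.

Local Lemma scDl c d m : sc (c + d) m = sc c m + sc d m.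
Proof. by rewrite /sc scalerDl ractDr. Qed.
Local Lemma scDr c m m' : sc c (m + m') = sc c m + sc c m'.
Proof. exact: ractDl. Qed.
Local Lemma sc0l m : sc 0 m = 0. Proof. by rewrite /sc scale0r [LHS]scale0r. Qed.
Local Lemma sc0r c : sc c 0 = 0. Proof. exact: scaler0. Qed.
Local Lemma sc1 m : sc 1 m = m. Proof. by rewrite /sc scale1r ract1. Qed.
Local Lemma scNl c m : sc (- c) m = - sc c m.
Proof. by rewrite /sc scaleNr [LHS]scaleNr. Qed.
Local Lemma scNr c m : sc c (- m) = - sc c m. Proof. exact: scalerN. Qed.

(** Partial linear functionals encoded as graphs; by linearity, single-valuedness need only be asked
    at 0. *)
Let good (G : set (M * k)) :=
  (forall c x s y t, G (x, s) -> G (y, t) -> G (sc c x + y, c * s + t)) /\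
  (forall s, G (0, s) -> s = 0).

Local Lemma good_maximal_total G0 G : good G -> (G0 `<=` G)%classic -> G0 (0, 0) ->
  (forall G', (G `<=` G')%classic -> good G' -> (G' `<=` G)%classic) ->
  forall m, exists s, G (m, s).
Proof.
move=> [Gcl Gfun] G0G G00 Gmax m; apply: contrapT => nm.
(* Extension of [G] to [m] by the value 0. *)
pose G' : set (M * k) := fun xs => exists (c : k) y, G (y, xs.2) /\ xs.1 = sc c m + y.
apply: (nm); exists 0; apply: (Gmax G').
- by move=> [x s] /= h; exists 0, x; split=> //; rewrite sc0l add0r.
- split.
    move=> c x s y t [d [x' [/= Gx ->]]] [d' [y' [/= Gy ->]]].
    exists (c * d + d'), (sc c x' + y'); split; first exact: Gcl.
    by rewrite /= scDl scDr scA addrACA.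
  move=> s [c [y [/= Gy e]]]; have [c0|cn0] := eqVneq c 0.
    move: e; rewrite c0 sc0l add0r => e.
    by apply: Gfun; rewrite e.
  case: nm; exists (- c^-1 * s + 0).
  have -> : m = sc (- c^-1) y + 0.
    have e' : 0 = sc c m + y := e.
    have -> : y = - sc c m by apply/eqP; rewrite -addr_eq0 addrC -e'.
    by rewrite scNr scNl opprK scA mulVf // sc1 addr0.
  exact: Gcl Gy (G0G _ G00).
- by exists 1, 0; split; [exact: G0G|rewrite sc1 addr0].
Qed.

Lemma functional_extension (U : M -> Prop) (f : M -> k) : U 0 ->
  (forall c x y, U x -> U y -> U (sc c x + y)) ->
  (forall c x y, U x -> U y -> f (sc c x + y) = c * f x + f y) -> 
  exists g, functional sc g /\ forall x, U x -> g x = f x.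
Proof.
move=> U0 Ucl flin; pose G0 : set (M * k) := fun xs => U xs.1 /\ xs.2 = f xs.1.
have f0 : f 0 = 0.
  by have := flin (-1) 0 0 U0 U0; rewrite sc0r addr0 mulN1r addNr.
have goodG0 : good G0.
  split=> [c x s y t [/= Ux ->] [/= Uy ->]|s [/= _ ->]]; last exact: f0.
  by split=> /=; [apply: Ucl|rewrite flin].
(* Asking that the union with [G0] be good, instead of asking [G] to contain [G0], makes the empty
   chain admissible. *)
have [F FP chain|G [gG Gmax]] := @Zorn_bigcup (M * k) (fun G => good (G `|` G0)%classic).
  have FG z : ((\bigcup_(X in F) X) `|` G0)%classic z ->
      G0 z \/ exists2 X, F X & X z.
    by case=> [[X FX Xz]|]; [right; exists X|left].
  have FGF X z : F X -> (X `|` G0)%classic z -> ((\bigcup_(X in F) X) `|` G0)%classic z.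
    by move=> FX [Xz|]; [left; exists X|right].
  split=> [c x s y t /FG zx /FG zy|s /FG zs].
    have [[h1 h2]|[X FX [h1 h2]]] : (G0 (x, s) /\ G0 (y, t)) \/
        exists2 X, F X & (X `|` G0)%classic (x, s) /\ (X `|` G0)%classic (y, t).
      case: zx zy => [zx|[X FX zx]] [zy|[Y FY zy]]; [by left|..]; right.
      - by exists Y => //; split; [right|left].
      - by exists X => //; split; [left|right].
      - have [XY|YX] := chain X Y FX FY.
          by exists Y => //; split; left=> //; apply: XY.
        by exists X => //; split; left=> //; apply: YX.
      by right; apply: goodG0.1.
    by apply: (FGF X) => //; apply: (FP X FX).1.
  by case: zs => [|[X FX Xs]]; [apply: goodG0.2|apply: (FP X FX).2; left].
have tot := good_maximal_total gG (@subsetUr _ _ _) (conj U0 (esym f0)).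
have [|g gP] := @choice _ _ (fun m s => (G `|` G0)%classic (m, s)).
  apply: tot => G' GG' gG' xs G'xs; apply: contrapT => nxs.
  apply: (Gmax G'); first by split=> [z Gz|/(_ _ G'xs) Gxs]; [apply: GG'; left|apply: nxs; left].
  have -> : (G' `|` G0 = G')%classic by apply/setUidPl => z G0z; apply: GG'; right.
  exact: gG'.
case: gG => Gcl Gfun.
have uniq m s t : (G `|` G0)%classic (m, s) -> (G `|` G0)%classic (m, t) -> s = t.
  move=> ms mt; have := Gcl (-1) m s m t ms mt.
  by rewrite scNl sc1 addNr mulN1r => /Gfun /eqP; rewrite addrC subr_eq0 => /eqP.
have G00 : (G `|` G0)%classic (0, 0) by right; split.
exists g; split; last by move=> x Ux; apply: (uniq x) => //; right.
split=> [x y|c x]; [apply: (uniq (x + y)) => //|apply: (uniq (sc c x)) => //].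
  by have := Gcl 1 _ _ _ _ (gP x) (gP y); rewrite sc1 mul1r.
by have := Gcl c _ _ _ _ (gP x) G00; rewrite !addr0.
Qed.

End Extension.

Lemma falg_span (k : fieldType) (A : falgType k) : exists (n : nat) (t : 'I_n -> A),
  forall a, exists c : 'I_n -> k, a = \sum_i c i *: t i.
Proof.
exists (\dim {:A}), (fun i => (vbasis {:A})`_i) => a.
by exists (fun i => coord (vbasis {:A}) i a); apply: coord_vbasis; apply: memvf.
Qed.

Section DualOfTop.
Variables (k : fieldType) (A : falgType k) (e : A).
Hypothesis pe : primitive_idempotent e.
Let he := primitive_idem pe.
Let x0 := eA_gen he.
Variables (S : right_mod A) (p : {linear eA e -> S}).
Hypotheses (pS : surj p) (pP : forall x, p x = 0 <-> radical x).
Hypothesis S1e : forall s : S, ract s (1 - e) = 0.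
Variables (L : left_mod A) (b : L -> S -> k).
Hypotheses (bD : forall l l' m, b (l + l') m = b l m + b l' m)
  (bfun : forall l, functional (fun c m => ract m c%:A) (b l))
  (bA : forall (a : A) l m, b (a *: l) m = b l (ract m a))
  (bnd : forall l, (forall m, b l m = 0) -> l = 0)
  (bsurj : forall phi : S -> k, functional (fun c m => ract m c%:A) phi ->
     exists l, forall m, phi m = b l m).

Implicit Types (l : L) (m s : S).

Lemma dual_b0l m : b 0 m = 0.
Proof. by apply: (addrI (b 0 m)); rewrite -bD !addr0. Qed.

Lemma dual_b0r l : b l 0 = 0.
Proof. exact: functional0 (bfun l). Qed.

Lemma dual_bsum (I : finType) (f : I -> L) m : b (\sum_i f i) m = \sum_i b (f i) m.
Proof. by apply: (big_morph (b^~ m)) => [l l'|]; [apply: bD|apply: dual_b0l]. Qed.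

Lemma dual_bsumr (I : finType) l (f : I -> S) : b l (\sum_i f i) = \sum_i b l (f i).
Proof. by apply: (big_morph (b l)); [apply: (bfun l).1|apply: dual_b0r]. Qed.

Lemma dual_bZ c l m : b (c%:A *: l) m = c * b l m.
Proof. by rewrite bA (bfun l).2. Qed.

Lemma dual_annihilated l : (1 - e) *: l = 0.
Proof. by apply: bnd => m; rewrite bA S1e dual_b0r. Qed.

Lemma dual_e l : e *: l = l.
Proof. by apply/eqP; rewrite -subr_eq0 -[X in _ - X]scale1r -scalerBl -opprB scaleNr dual_annihilated oppr0. Qed.

(** On the line spanned by a nonzero [s], the coefficient of [s] is a functional; it extends to
    [S]. *)
Lemma dual_separates s : (forall l, b l s = 0) -> s = 0.
Proof.
move=> bs; apply: contrapT => s0.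
have inj (c d : k) : ract s c%:A = ract s d%:A -> c = d.
  move=> cd; apply/eqP; rewrite -subr_eq0; apply/negPn/negP => nz; apply: s0.
  have : ract s (c - d)%:A = 0 by rewrite scalerBl ractBr cd subrr.
  move/(congr1 (fun m => ract m (c - d)^-1%:A)).
  by rewrite ractA -scalerAl mul1r scalerA mulfV // scale1r ract1 [RHS]scaler0.
pose U m := exists c : k, m = ract s c%:A.
have /choice[f fP] : forall m, exists c : k, U m -> m = ract s c%:A.
  by move=> m; have [[c cE]|nU] := pselect (U m); [exists c|exists 0].
have Ucl c x y : U x -> U y -> U (ract x c%:A + y).
  move=> [a ->] [d ->]; exists (a * c + d).
  by rewrite ractA -scalerAl mul1r scalerA scalerDl ractDr.
have [||c x y Ux Uy|g [gfun gU]] := @functional_extension _ _ S U f.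
- by exists 0; rewrite scale0r [RHS]scale0r.
- exact: Ucl.
- apply: inj; rewrite -(fP _ (Ucl c x y Ux Uy)) [in LHS](fP _ Ux) [in LHS](fP _ Uy).
  by rewrite ractA -scalerAl mul1r scalerA -ractDr -scalerDl mulrC.
have [l lP] := bsurj gfun.
have Us : U s by exists 1; rewrite scale1r ract1.
have : f s = 0 by rewrite -gU // lP bs.
move=> fs0; apply: s0; rewrite (fP _ Us) fs0 scale0r; exact: scale0r.
Qed.

Lemma dual_generator : exists l : L, l <> 0.
Proof.
apply: contrapT => h; apply: (top_gen_neq0 pP); apply: dual_separates => l.
have -> : l = 0 by apply: contrapT => l0; apply: h; exists l.
exact: dual_b0l.
Qed.

(** The elements of [S] killed by all [a *: l] form a proper submodule of a simple module, hence
    zero. So the functionals [t i *: l] have no common zero and span the dual. *)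
Lemma dual_cyclic l : l <> 0 -> forall l', exists a : A, l' = a *: l.
Proof.
move=> l0 l'; have [n [t tP]] := falg_span A.
have [s sP|c cP] := @functional_span _ S _ n (fun i => b (t i *: l)) (b l')
  (fun i => bfun _) (bfun l').
  pose V s := forall a : A, b (a *: l) s = 0.
  have hV : is_submod V.
    split=> [a|c x y Vx Vy a]; first exact: dual_b0r.
    rewrite (bfun _).1 Vy addr0 -[c *: x]/(ract x c) -bA scalerA; exact: Vx.
  have Vs : V s.
    move=> a; have [c ->] := tP a; rewrite scaler_suml dual_bsum big1 // => i _.
    by rewrite -mulr_algl -scalerA dual_bZ sP mulr0.
  rewrite (top_simple pS pP hV _ Vs) ?dual_b0r // => Vp; apply: l0; apply: bnd => m.
  by have [a ->] := top_genP pe pS m; rewrite -bA.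
exists (\sum_i c i *: t i); apply/eqP; rewrite -subr_eq0; apply/eqP/bnd => m.
rewrite bD; have -> : - ((\sum_i c i *: t i) *: l) = (-1)%:A *: ((\sum_i c i *: t i) *: l).
  by rewrite [(-1)%:A]scaleN1r scaleN1r.
rewrite dual_bZ mulN1r cP scaler_suml dual_bsum; apply/eqP; rewrite subr_eq0; apply/eqP.
by apply: eq_bigr => i _; rewrite -[c i *: t i]mulr_algl -scalerA dual_bZ.
Qed.

(** The finitely many evaluations at [ract (p x0) (t i)] separate [L], so they span its dual. *)
Lemma dual_reflexive F : functional (fun c (l : L) => c%:A *: l) F ->
  exists s, forall l, F l = b l s.
Proof.
move=> hF; have [n [t tP]] := falg_span A.
have [i||l lP|c cP] := @functional_span _ L (fun c (l : L) => c%:A *: l) n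
  (fun i l => b l (ract (p x0) (t i))) F.
- by split=> [l l'|c l]; rewrite ?bD ?dual_bZ.
- exact: hF.
- have -> : l = 0.
    apply: bnd => m; have [a ->] := top_genP pe pS m; have [c ->] := tP a.
    rewrite /ract scaler_suml dual_bsumr big1 // => i _.
    rewrite -/(ract _ _) -[c i *: t i]mulr_algr -ractA (bfun _).2.
    by rewrite lP mulr0.
  exact: functional0 hF.
exists (\sum_i ract (p x0) (c i *: t i)) => l; rewrite cP dual_bsumr.
by apply: eq_bigr => i _; rewrite -[c i *: t i]mulr_algr -ractA (bfun _).2.
Qed.

(** The condition says that L is isomorphic to Ae, whose dual is injective. Concretely, the
    functional [b l0 \o f] is extended to [h] on [Y], and [y] is sent to the element of [S] that
    represents [a *: l0 |-> h (y a e)]. *)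
Lemma dual_free_injective l0 : l0 <> 0 -> (forall a : A, a *: l0 = 0 -> a * e = 0) ->
  injective_mod S.
Proof.
move=> l0n free X Y i f iI.
pose U y := exists x : X, i x = y.
have /choice[g gP] : forall y, exists c : k, forall x, i x = y -> c = b l0 (f x).
  move=> y; have [[x xE]|nU] := pselect (U y); last by exists 0 => x xE; case: nU; exists x.
  by exists (b l0 (f x)) => x'; rewrite -xE => /iI ->.
have [|||h [hfun hU]] := @functional_extension _ _ Y U g.
- by exists 0; rewrite linear0.
- by move=> c _ _ [x <-] [y <-]; exists (ract x c%:A + y); rewrite linearD linear_ract.
- move=> c _ _ [x <-] [y <-]; rewrite (gP _ (ract x c%:A + y)); last first.
    by rewrite linearD linear_ract.
  by rewrite linearD linear_ract (bfun _).1 (bfun _).2 (gP _ x) // (gP _ y).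
have cyc := dual_cyclic l0n.
have fe (s : S) : ract s e = s.
  by apply/eqP; rewrite -subr_eq0 -opprB -[X in X - _]ract1 -ractBr S1e oppr0.
have ex y : exists s, forall a : A, b (a *: l0) s = h (ract y (a * e)).
  have /choice[F FP] : forall l, exists c, forall a : A, l = a *: l0 -> c = h (ract y (a * e)).
    move=> l; have [a lE] := cyc l; exists (h (ract y (a * e))) => a' a'E.
    have /free : (a - a') *: l0 = 0 by rewrite scalerBl -lE -a'E subrr.
    by rewrite mulrBl => /eqP; rewrite subr_eq0 => /eqP ->.
  have [|s sP] := @dual_reflexive F.
    split=> [l l'|c l].
      have [a ->] := cyc l; have [a' ->] := cyc l'.
      by rewrite (FP _ _ erefl) (FP _ _ erefl) (FP _ (a + a')) ?scalerDl // mulrDl ractDr hfun.1.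
    have [a ->] := cyc l; rewrite (FP _ _ erefl) (FP _ (c%:A * a)) ?scalerA //.
    by rewrite -hfun.2 ractA -scalerAl mul1r -scalerAl -scalerAr mulr1.
  by exists s => a; rewrite -sP; apply: FP.
have [|y s s' hs hs'||r rP] := @linear_choice _ Y S
   (fun y s => forall a : A, b (a *: l0) s = h (ract y (a * e))).
- exact: ex.
- apply/eqP; rewrite -subr_eq0; apply/eqP/dual_separates => l; have [a ->] := cyc l.
  by rewrite (functionalB _ _ (bfun _)) hs hs' subrr.
- move=> c y y' s s' hs hs' a.
  rewrite (bfun _).1 -[c *: s]/(ract s c) -bA scalerA hs hs'.
  by rewrite ractDl hfun.1 -[c *: y]/(ract y c) ractA mulrA.
exists r => x; apply/eqP; rewrite -subr_eq0; apply/eqP/dual_separates => l.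
have [a ->] := cyc l; rewrite (functionalB _ _ (bfun _)) rP -linear_ract hU; last first.
  by exists (ract x (a * e)).
rewrite (gP _ _ erefl) linear_ract.
by rewrite -(bA (a * e)) -scalerA dual_e subrr.
Qed.

End DualOfTop.

(** * The approximation sequence *)

(* The right module [Hom_A(P, A)]; [ev c] is the linear map encoded by [c]. *)
Lemma exists_dual_module (k : fieldType) (A : falgType k) (P : left_mod A) :
  exists (D : right_mod A) (ev : D -> {linear P -> A^o}),
  [/\ forall (a : A) c c' y, ev (ract c a + c') y = (ev c y : A) * a + ev c' y,
      forall c c', (forall y, ev c y = ev c' y) -> c = c'
    & forall phi : {linear P -> A^o}, exists c, forall y, ev c y = phi y].
Proof.
pose F : lmodType A^c := (P -> reg_right A).
pose U (c : F) := linear (c : P -> A^o).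
have hU : is_submod U.
  split=> [a x y|a c c' hc hc' b x y]; first by rewrite [RHS]addr0 [RHS]mulr0.
  have E z : (a *: c + c') z = (c z : A) * a + c' z by [].
  rewrite !E hc hc' mulrDl scalerDr addrACA; congr (_ + _ + _).
  exact: esym (mulrA _ _ _).
have [D [j [jI jP]]] := sub_modP hU.
have lin c : linear (j c : P -> A^o) by apply/jP; exists c.
exists D, (fun c => mk_linear (lin c)); split=> [a c c' y|c c' e|phi].
- by rewrite /= linearP.
- by apply: jI; apply/funext.
have [|c cE] := (jP (phi : P -> reg_right A)).1; first exact: linearP.
by exists c => y; rewrite /= cE.
Qed.

Lemma mulr_linear (k : fieldType) (A : falgType k) (P : left_mod A)
  (phi : {linear P -> A^o}) (v : A) : linear (fun y => (phi y : A) * v : A^o).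
Proof. by move=> a x y; rewrite linearP mulrDl -mulrA. Qed.

(** * The minimal presentation of the dual of the top *)

Section LeftPresentation.
Variables (k : fieldType) (A : falgType k) (e : A).
Hypothesis pe : primitive_idempotent e.
Let he := primitive_idem pe.
Let x0 := eA_gen he.
Variables (L P0 P1 : left_mod A) (p1 : {linear P1 -> P0}) (p0 : {linear P0 -> L}).
Hypothesis pres : min_proj_presentation p1 p0.
Hypotheses (L1e : forall l : L, (1 - e) *: l = 0) (L0 : exists l : L, l <> 0)
  (Lcyc : forall l : L, l <> 0 -> forall l', exists a : A, l' = a *: l).

Lemma annihilated_fix (l : L) : e *: l = l.
Proof. by apply/eqP; rewrite eq_sym -subr_eq0 -[X in X - _]scale1r -scalerBl L1e. Qed.

Lemma projective_cover_generator : exists (z : P0) (eps : {linear P0 -> A^o}),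
  [/\ e *: z = z, (eps z : A) = e, forall w, w = (eps w : A) *: z & p0 z <> 0].
Proof.
case: pres => [[[_ pr0] _] p0S _ sup0 _].
have [l ln0] := L0; have [w wl] := p0S l; set z := e *: w.
have pz : p0 z = l by rewrite linearZ /= wl annihilated_fix.
have gen : forall x, exists a : A, x = a *: z.
  apply: (sup0 _ (line_submod z)) => x; have [a aE] := Lcyc ln0 (p0 x).
  exists (a *: z), (x - a *: z); split; first by exists a.
    by rewrite linearB linearZ /= pz aE subrr.
  by rewrite addrC subrK.
have lz : linear (fun a : A^o => (a : A) *: z).
  by move=> a x y; rewrite scalerDl scalerA.
have [|s sP] := pr0 _ _ (mk_linear lz) idfun.
  by move=> x; have [a ->] := gen x; exists a.
pose eps := mk_linear (mulr_linear s e).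
have ez : e *: z = z by rewrite scalerA he.
have epsz x : x = (eps x : A) *: z by rewrite /eps /= -scalerA ez; symmetry; exact: sP.
set g : A := eps z.
have epsE x : (eps x : A) = (eps x : A) * g by rewrite {1}[x]epsz linearZ.
have gg : g * g = g by rewrite -epsE.
have eg : e * g = g by rewrite -[RHS]/(eps z : A) -[in RHS]ez linearZ.
have ge : g * e = g by rewrite /g /eps /= -mulrA he.
exists z, eps; split=> //; last by rewrite pz.
have [g0|//] := primitive_split pe gg eg ge.
by case: ln0; rewrite -pz [z]epsz -/g g0 scale0r linear0.
Qed.

Variables (S : right_mod A) (p : {linear eA e -> S}).
Hypotheses (pP : forall x, p x = 0 <-> radical x)
  (gen : forall V : eA e -> Prop, is_submod V ->
    (forall r, p r = 0 -> V (ract r (1 - e))) -> forall r, p r = 0 -> V r).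

(** An element of eAe outside the radical is invertible in eAe and so cannot kill a nonzero vector
    fixed by e. *)
Lemma annihilator_radical (l : L) (r : eA e) : l <> 0 -> (eA_val r : A) *: l = 0 ->
  (eA_val r : A) * e = eA_val r -> p r = 0.
Proof.
move=> ln0 rl re; apply: contrapT => pr.
have ux0 : eA_hom e r x0 = r.
  by apply: eA_val_inj; rewrite eA_hom_apply eA_val_ract (eA_genE he).
have uI : injective (eA_hom e r) by apply: (eA_endo_inj pP); rewrite -/x0 ux0.
have [t tE] := inj_endo_surj (eA_finite_length he) uI x0.
have rt : (eA_val r : A) * eA_val t = e.
  by have := eA_genE he; rewrite -/x0 -tE eA_hom_apply eA_val_ract.
have : ract t (eA_val r) = x0.
  apply: uI; rewrite ux0; apply: eA_val_inj.
  by rewrite eA_hom_apply !eA_val_ract mulrA rt eA_valE.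
move/(congr1 eA_val); rewrite eA_val_ract (eA_genE he) => tr.
by apply: ln0; rewrite -(annihilated_fix l) -tr -scalerA rl scaler0.
Qed.

(** Here the right-handed [gen] yields left-handed information. With [U] generated by (1-e)P1, it
    gives r z in p1(U) for every r in the radical of eA; the coordinate of p1(e y) is such an r, so
    P1 = U + ker p1. *)
Lemma syzygy_generators : exists (I : finType) (x : I -> P1),
  (forall i, (1 - e) *: x i = x i) /\
  (forall y, exists a : I -> A, y = \sum_i a i *: x i).
Proof.
case: pres => [[_ [[m [v vP]] pr1]] p0S ex sup0 sup1].
have [n [t tP]] := falg_span A.
have [z [eps [ez epsz epsE pz]]] := projective_cover_generator.
pose x (i : 'I_n * 'I_m) := ((1 - e) * t i.1) *: v i.2.
exists ('I_n * 'I_m)%type, x.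
have ii : (1 - e) * (1 - e) = 1 - e by rewrite mulrBr mulr1 mulrBl mul1r he subrr subr0.
split=> [i|]; first by rewrite scalerA mulrA ii.
pose U y := exists a : 'I_n * 'I_m -> A, y = \sum_i a i *: x i.
have hU : is_submod U.
  split; first by exists (fun=> 0); rewrite big1 // => i _; rewrite scale0r.
  move=> c _ _ [a ->] [a' ->]; exists (fun i => c * a i + a' i).
  rewrite scaler_sumr -big_split; apply: eq_bigr => i _.
  by rewrite /= scalerDl scalerA.
have U1e y : U ((1 - e) *: y).
  have [a ->] := vP y; rewrite scaler_sumr; apply: submod_sum => // i _.
  have [c ->] := tP (a i); rewrite scaler_suml scaler_sumr; apply: submod_sum => // j _.
  rewrite -[c j *: t j]mulr_algl scalerA mulrA.
  have -> : (1 - e) * (c j)%:A = (c j)%:A * (1 - e) by rewrite mulr_algl mulr_algr.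
  rewrite -mulrA -scalerA; apply: submodZ => //.
  exists (fun i' => (i' == (j, i))%:R); rewrite (bigD1 (j, i)) //= eqxx scale1r big1 ?addr0 //.
  by move=> i' /negPf ->; rewrite scale0r.
(* Quantifying over [a] makes [V] a right submodule, as [gen] requires; only [a = 1] is used at the
   end. *)
pose V (r : eA e) := forall a, exists2 u, U u & p1 u = ((eA_val r : A) * a) *: z.
have hV : is_submod V.
  split=> [a|c r r' Vr Vr' a]; first by exists 0; [apply: submod0|rewrite !linear0 mul0r scale0r].
  have [u Uu uE] := Vr ((c : A) * a); have [u' Uu' u'E] := Vr' a.
  exists (u + u'); first exact: submodD.
  rewrite linearD uE u'E linearD -scalerDl mulrA -mulrDl.
  by rewrite -[c *: r]/(ract r c) eA_val_ract.
have V1e r : p r = 0 -> V (ract r (1 - e)).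
  move=> _ a; have [|y yE] := (ex (((1 - e) * a) *: z)).1.
    by rewrite -scalerA linearZ /= L1e.
  exists ((eA_val r : A) *: ((1 - e) *: y)); first exact: submodZ.
  by rewrite eA_val_ract !linearZ /= yE !scalerA !mulrA -[_ * (1 - e) * (1 - e)]mulrA ii.
apply: (sup1 U) => // y.
have [r rE] : exists r : eA e, eA_val r = eps (p1 (e *: y)).
  exists (eA_proj he (eps (p1 (e *: y)))); rewrite eA_projE.
  by rewrite -[e * _]/(e *: (eps _)) -!linearZ /= scalerA he.
have pr : p r = 0.
  apply: (annihilator_radical pz).
    by rewrite rE -linearZ /= -epsE; apply/ex; exists (e *: y).
  by rewrite rE -[X in _ * X]epsz -[_ * _]/(_ *: eps z) -linearZ -epsE.
have [u Uu uE] := gen hV V1e pr 1.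
exists ((1 - e) *: y + u), (e *: y - u); split; first exact: submodD.
  by rewrite linearB uE mulr1 rE -epsE subrr.
by rewrite scalerBl scale1r addrACA subrr addr0 subrK.
Qed.

End LeftPresentation.

(* If [M] has projective dimension at most one, then a presentation
   [X -> D -> M -> 0] by projectives identifies the image of [X] with a summand
   of [X]: by Schanuel's lemma that image is projective. *)
Lemma pd1_split (R : nzRingType) (X D M : lmodType R) (f : {linear X -> D})
    (g : {linear D -> M}) : projective X -> projective D -> surj g ->
  (forall c, g c = 0 <-> exists u, f u = c) -> pd_le 1 M ->
  exists theta : {linear X -> X},
    (forall u, f (theta u) = f u) /\ (forall u, f u = 0 -> theta u = 0).
Proof.
move=> prX prD gS gP [Q [eps [[Qpr _ epsS eps0 Qex] Qz]]].
pose d : {linear Q (Negz 0) -> Q (Posz 0)} := diff Q (Negz 0).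
have dI y : d y = 0 -> y = 0.
  move=> dy; have [w <-] := (Qex (Negz 1) erefl y).1 dy.
  by rewrite (Qz (Negz 1) erefl w) linear0.
have [a aP] := prD _ _ eps g epsS.
have [b bP] := (Qpr (Posz 0)).2 _ _ g eps gS.
have [|t tP] := @projective_lift _ _ _ _ f (b \o d) (Qpr (Negz 0)).2.
  by move=> y; apply/gP; rewrite /= bP; apply/eps0; exists y.
have [|s sP] := @projective_lift _ _ _ _ f (idfun \- (b \o a)) prD.
  by move=> c; apply/gP; rewrite /= linearB bP aP subrr.
have [|m mP] := @projective_lift _ _ _ _ d (a \o f) prX.
  by move=> u; apply/eps0; rewrite /= aP; apply/gP; exists u.
(* After applying [f], the summands become f - b a f and b d m = b a f. On ker f the map [m]
   vanishes because [d] is injective. *)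
exists ((s \o f) \+ (t \o m)); split=> u /=.
  by rewrite linearD sP tP /= mP subrK.
by move=> fu; rewrite fu linear0 add0r (dI (m u)) ?linear0 // mP /= fu linear0.
Qed.

(* The properties of [0 -> X -f-> D -g-> M -> 0] on which the theorem rests:
   [f] is a non-split minimal left [add E]-approximation, with cokernel [M]. *)
Definition approx_sequence (R : nzRingType) (X E D M : lmodType R)
    (f : {linear X -> D}) (g : {linear D -> M}) : Prop :=
  [/\ [/\ fin_gen D /\ projective D, injective f, surj g
        & forall c, g c = 0 <-> exists u, f u = c],
      exists (I : finType) (a : I -> {linear D -> E}) (b : I -> {linear E -> D}),
        forall c, c = \sum_i b i (a i c),
      forall h : {linear X -> E}, exists h' : {linear D -> E}, forall u, h' (f u) = h u,
      forall h : {linear D -> D}, (forall u, h (f u) = f u) -> injective h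
    & ~ exists r : {linear D -> X}, cancel f r].

Section ApproximationSequence.
Variables (k : fieldType) (A : falgType k) (e : A) (S tauS : right_mod A).
Hypotheses (basicA : basic_algebra A) (pe : primitive_idempotent e)
  (topS : is_top (eA e) S) (tauP : is_tau_inv S tauS) (extS : Ext1_zero S S)
  (pdS : pd_le 1 tauS) (ninjS : ~ injective_mod S).
Let he := primitive_idem pe.
Let x0 := eA_gen he.

Lemma compl_idem : idempotent (1 - e).
Proof. by rewrite /idempotent mulrBr mulr1 mulrBl mul1r (he : e * e = e) subrr subr0. Qed.

Let he' := compl_idem.

Lemma exists_approx_sequence : exists (D : right_mod A) (f : {linear eA e -> D})
  (g : {linear D -> tauS}), approx_sequence (eA (1 - e)) f g.
Proof.
have [p [pS pP]] := topS.
have [L [[b [bD bfun bA bnd bsurj]] [P0 [P1 [p1 [p0 [q [pres qlin qS qP]]]]]]]] := tauP.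
have S1e := top_annihilated pe pS pP basicA.
have bsurj' (phi : S -> k) : functional (fun c m => ract m c%:A) phi ->
    exists l, forall m, phi m = b l m by case=> h1 h2; apply: bsurj.
have L1e := dual_annihilated S1e bfun bA bnd.
have Lcyc := dual_cyclic pe pS pP bD bfun bA bnd.
have L0 := dual_generator pe pP bD bsurj'.
have [z [eps [ez epsz epsE pz]]] := projective_cover_generator pe pres L1e L0 Lcyc.
have [I [x [x1e xgen]]] := syzygy_generators pe pres L1e L0 Lcyc pP
  (fun V => radical_generated pe pS pP (V := V) extS).
case: (pres) => [[_ [_ pr1]] p0S ex _ sup1].
have [phi phiP] := projective_dual_basis pr1 xgen.
have [D [ev [evP evI evS]]] := exists_dual_module P1.
have evl_lin y : linear (fun c : D => ev c y : reg_right A) by move=> a c c'; exact: evP.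
pose evl y : {linear D -> reg_right A} := mk_linear (evl_lin y).
have evlE c y : evl y c = ev c y by [].
have epse w : (eps w : A) * e = eps w by rewrite [in RHS](epsE w) linearZ /= epsz.
(* [f] is Hom(p1, A), with [u] in eA regarded as the map [w |-> eps w * u] on P0. *)
have [|||f fP] := @linear_choice _ (eA e) D
    (fun u c => forall y, ev c y = (eps (p1 y) : A) * eA_val u).
- move=> u; have [c cE] := evS (mk_linear (mulr_linear (eps \o p1) (eA_val u))).
  by exists c.
- by move=> u c c' hc hc'; apply: evI => y; rewrite hc hc'.
- move=> a u u' c c' hc hc' y; rewrite [LHS]evP hc hc' linearP mulrDr.
  by rewrite -mulrA.
(* [q] takes bundled maps; its linearity clause with scalar 1 and summand [\0] shows that only their
   values matter. *)
have qext (chi psi : {linear P1 -> A^o}) : (forall y, chi y = psi y) -> q chi = q psi.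
  move=> e1; rewrite (qlin 1 psi \0 chi) => [|y]; last by rewrite e1 mulr1 [RHS]addr0.
  rewrite ract1 (_ : q \0 = 0) ?addr0 //.
  by apply/qP; exists \0.
have lg : linear (fun c => q (ev c)) by move=> a c c'; apply: qlin => y; exact: evP.
pose g : {linear D -> tauS} := mk_linear lg.
have gS : surj g.
  by move=> s; have [chi <-] := qS s; have [c cE] := evS chi; exists c; apply: qext.
have gP c : g c = 0 <-> exists u, f u = c.
  split=> [/qP[psi psiP]|[u <-]]; last first.
    by apply/qP; exists (mk_linear (mulr_linear eps (eA_val u))) => y; rewrite fP.
  exists (eA_proj he (psi z)); apply: evI => y.
  by rewrite fP eA_projE mulrA epse psiP [in RHS](epsE (p1 y)) linearZ.
pose d i : D := projT1 (cid (evS (phi i))).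
have dE i y : ev (d i) y = phi i y by exact: projT2 (cid (evS (phi i))) y.
have dsum c : c = \sum_i ract (d i) (ev c (x i)).
  apply: evI => y; rewrite -[RHS]evlE [RHS]linear_sum [in LHS](phiP y) linear_sum.
  by apply: eq_bigr => i _; rewrite linear_ract evlE dE linearZ.
exists D, f, g.
(* The coordinates of [f x0] are the [eps (p1 (x i))], which kill [p0 z]. A retraction would turn
   this into e p0 z = 0. *)
have nonsplit : ~ exists r : {linear D -> eA e}, cancel f r.
  case=> r rK; apply: pz; rewrite -ez linearZ /= -(eA_genE he) -/x0 -(rK x0).
  rewrite [f x0]dsum !linear_sum scaler_suml big1 // => i _.
  rewrite linear_ract eA_val_ract fP eA_genE epse -scalerA.
  have -> : (eps (p1 (x i)) : A) *: p0 z = 0 by rewrite -linearZ /= -epsE; apply/ex; exists (x i).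
  by rewrite scaler0.
have basisD : @dual_basis _ D I d (fun i => evl (x i)) by exact: dsum.
have prD := dual_basis_projective basisD.
split=> //.
- split=> //; first by split=> //; apply: dual_basis_fin_gen basisD.
  have [theta [fth th0]] := pd1_split (eA_projective he) prD gS gP pdS.
  (* If theta is nilpotent then f = f theta^n = 0, hence p1 = 0; so P0 is L, and S would be
     injective. *)
  have [thI|[n thn]] := fitting (eA_finite_length he) (primitive_indec pe) theta.
    by apply: linear_inj => u /th0 thu; apply: thI; rewrite thu linear0.
  have f0 u : f u = 0 by rewrite -(lin_pow2_absorb n fth) thn linear0.
  have p10 y : p1 y = 0.
    rewrite [LHS]epsE -epse -(eA_genE he) -fP f0 -evlE linear0.
    exact: scale0r.
  case: ninjS; apply: (dual_free_injective pe pS pP S1e bD bfun bA bnd bsurj' pz) => a az.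
  have [|y yE] := (ex (a *: z)).1; first by rewrite linearZ.
  by rewrite -epsz -[_ * _]/(a *: eps z) -linearZ -yE p10 linear0.
- have [bb bbP] : exists bb : I -> {linear eA (1 - e) -> D},
      forall i t y, ev (bb i t) y = (phi i y : A) * eA_val t.
    have h i : exists bb : {linear eA (1 - e) -> D},
        forall t y, ev (bb t) y = (phi i y : A) * eA_val t.
      apply: (@linear_choice _ (eA (1 - e)) D
        (fun t c => forall y, ev c y = (phi i y : A) * eA_val t)).
      + by move=> u; have [c cE] := evS (mk_linear (mulr_linear (phi i) (eA_val u))); exists c.
      + by move=> u c c' hc hc'; apply: evI => y; rewrite hc hc'.
      + move=> a u u' c c' hc hc' y; rewrite [LHS]evP hc hc' linearP mulrDr.
        by rewrite -mulrA.
    by have [bb bbP] := choice h; exists bb.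
  (* As (1-e) fixes [x i], evaluation at [x i] already takes values in (1-e)A. *)
  exists I, (fun i => eA_proj he' \o evl (x i)), bb => c; apply: evI => y.
  rewrite -[RHS]evlE linear_sum [in LHS](phiP y) linear_sum; apply: eq_bigr => i _.
  rewrite evlE bbP eA_projE linearZ evlE -[in LHS](x1e i) linearZ.
  by [].
- move=> h; pose v : A := eA_val (h x0).
  have v1e : (1 - e) * v = v by exact: eA_valE.
  have ve : v * e = v by rewrite /v -eA_val_ract eA_hom_e.
  (* Since v = (1-e)v, the element v z lies in ker p0; evaluation at a preimage [y] in P1 is the
     factorization through [f]. *)
  have [|y yE] := (ex (v *: z)).1; first by rewrite -v1e -scalerA linearZ /= L1e.
  exists (eA_proj he' \o evl y) => u; apply: eA_val_inj.
  have epsv : eps (v *: z) = v by rewrite linearZ /= epsz; exact: ve.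
  rewrite eA_projE evlE fP yE epsv mulrA v1e.
  by rewrite (eA_homE he h) eA_val_ract.
- move=> h hf.
  have ls : linear (fun y => \sum_i (ev (h (d i)) y : A) *: x i).
    move=> a y y'; rewrite scaler_sumr -big_split; apply: eq_bigr => i _.
    by rewrite linearP scalerDl scalerA.
  pose hs := mk_linear ls.
  have evhs c y : ev c (hs y) = ev (h c) y.
    rewrite [in RHS](dsum c) linear_sum -[RHS]evlE !linear_sum; apply: eq_bigr => i _.
    by rewrite !linear_ract evlE linearZ.
  have p1hs y : p1 (hs y) = p1 y.
    rewrite [LHS]epsE [RHS]epsE; congr (_ *: _).
    by rewrite -epse -[RHS]epse -(eA_genE he) -!fP evhs hf.
  have hsS : surj hs.
    apply: (sup1 _ (im_submod hs)) => y; exists (hs y), (y - hs y); split; first by exists y.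
      by rewrite linearB p1hs subrr.
    by rewrite addrC subrK.
  apply: linear_inj => c hc; apply: evI => y; have [y' <-] := hsS y.
  by rewrite evhs hc -!evlE !linear0.
Qed.

End ApproximationSequence.

(** * Homotopies and cones *)

Section Homotopy.
Variable R : nzRingType.
Implicit Types B C D E : complex R.

Lemma homotopic_eq C D (f g : chmap C D) : (forall i x, f i x = g i x) -> homotopic f g.
Proof.
by move=> e; exists (fun i => \0) => i x; rewrite e subrr linear0 /= addr0.
Qed.

Lemma homotopic_sym C D (f g : chmap C D) : homotopic f g -> homotopic g f.
Proof.
case=> h hP; exists (fun i => \- h i) => i x.
by rewrite -opprB hP /= linearN opprD.
Qed.

Lemma homotopic_trans C D (f g h : chmap C D) :
  homotopic f g -> homotopic g h -> homotopic f h.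
Proof.
case=> s sP [t tP]; exists (fun i => s i \+ t i) => i x.
by rewrite -[LHS](subrKA (g (i + 1) x)) sP tP /= linearD addrACA.
Qed.

Lemma homotopic_compl C D E (g : chmap D E) (f f' : chmap C D) :
  homotopic f f' -> homotopic (compC g f) (compC g f').
Proof.
case=> h hP; exists (fun i => g i \o h i) => i x.
by rewrite /= -linearB hP linearD chmapP.
Qed.

Lemma homotopic_compr C D E (f f' : chmap D E) (g : chmap C D) :
  homotopic f f' -> homotopic (compC f g) (compC f' g).
Proof.
by case=> h hP; exists (fun i => h i \o g (i + 1)) => i x; rewrite /= hP chmapP.
Qed.

Lemma homotopic_assoc B C D E (f : chmap D E) (g : chmap C D) (h : chmap B C) :
  homotopic (compC (compC f g) h) (compC f (compC g h)).
Proof. exact: homotopic_eq. Qed.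

Lemma homotopic_idl C D (f : chmap C D) : homotopic (compC (idC D) f) f.
Proof. exact: homotopic_eq. Qed.

Lemma homotopic_idr C D (f : chmap C D) : homotopic (compC f (idC C)) f.
Proof. exact: homotopic_eq. Qed.

Lemma isoK_of_inverses C D (f : chmap C D) (l r : chmap D C) :
  homotopic (compC l f) (idC C) -> homotopic (compC f r) (idC D) -> is_isoK f.
Proof.
move=> lf fr; exists l; split=> //; apply: homotopic_trans (fr); apply: homotopic_compl.
apply: homotopic_trans (homotopic_sym (homotopic_idr l)) _.
apply: homotopic_trans (homotopic_compl l (homotopic_sym fr)) _.
apply: homotopic_trans (homotopic_sym (homotopic_assoc l f r)) _.
by apply: homotopic_trans (homotopic_compr r lf) _; apply: homotopic_idl.
Qed.

Lemma isoK_factor C D (f : chmap C D) (l r : chmap D C) :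
  is_isoK (compC l f) -> is_isoK (compC f r) -> is_isoK f.
Proof.
case=> u [ulf _] [v [_ frv]]; apply: (@isoK_of_inverses _ _ f (compC u l) (compC r v)).
  exact: homotopic_trans (homotopic_assoc u l f) ulf.
exact: homotopic_trans (homotopic_sym (homotopic_assoc f r v)) frv.
Qed.

Lemma is_isoK_homotopic C D (f g : chmap C D) : homotopic f g -> is_isoK f -> is_isoK g.
Proof.
move=> fg [f' [f'f ff']]; exists f'; split.
  exact: homotopic_trans (homotopic_compl f' (homotopic_sym fg)) f'f.
exact: homotopic_trans (homotopic_compr f' (homotopic_sym fg)) ff'.
Qed.

Lemma is_isoK_comp C D E (g : chmap D E) (f : chmap C D) :
  is_isoK g -> is_isoK f -> is_isoK (compC g f).
Proof.
case=> g' [g'g gg'] [f' [f'f ff']]; exists (compC f' g'); split.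
  apply: homotopic_trans (homotopic_assoc f' g' (compC g f)) _.
  apply: homotopic_trans f'f; apply: homotopic_compl.
  apply: homotopic_trans (homotopic_sym (homotopic_assoc g' g f)) _.
  by apply: homotopic_trans (homotopic_compr f g'g) _; apply: homotopic_idl.
apply: homotopic_trans (homotopic_assoc g f (compC f' g')) _.
apply: homotopic_trans gg'; apply: homotopic_compl.
apply: homotopic_trans (homotopic_sym (homotopic_assoc f f' g')) _.
by apply: homotopic_trans (homotopic_compr g' ff') _; apply: homotopic_idl.
Qed.

Lemma isoK_refl C : isoK C C.
Proof. by exists (idC C), (idC C); split; apply: homotopic_eq. Qed.

Lemma isoK_sym C D : isoK C D -> isoK D C.
Proof. by case=> f [g [gf fg]]; exists g, f. Qed.

Lemma isoK_trans C D E : isoK C D -> isoK D E -> isoK C E.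
Proof. by case=> f hf [g hg]; exists (compC g f); apply: is_isoK_comp. Qed.

Lemma isoK_strict C D (f : chmap C D) (g : chmap D C) :
  (forall i x, g i (f i x) = x) -> (forall i x, f i (g i x) = x) -> is_isoK f.
Proof. by move=> gf fg; exists g; split; apply: homotopic_eq. Qed.

Lemma pair_chmapP C D C' D' (f : chmap C C') (g : chmap D D') i (x : dsumC C D i) :
  (f (i + 1) (diff (dsumC C D) i x).1, g (i + 1) (diff (dsumC C D) i x).2) =
  diff (dsumC C' D') i (f i x.1, g i x.2).
Proof. by rewrite /= /dsumC_diff /= !chmapP. Qed.

Definition dsum_map C D C' D' (f : chmap C C') (g : chmap D D') :
  chmap (dsumC C D) (dsumC C' D') :=
  @Chmap R (dsumC C D) (dsumC C' D')
    (fun i => ppair (f i \o pfst (C i) (D i)) (g i \o psnd (C i) (D i)))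
    (pair_chmapP f g).

Lemma homotopic_dsum C D C' D' (f f' : chmap C C') (g g' : chmap D D') :
  homotopic f f' -> homotopic g g' -> homotopic (dsum_map f g) (dsum_map f' g').
Proof.
case=> s sP [t tP].
exists (fun i => ppair (s i \o pfst (C (i + 1)) (D (i + 1))) (t i \o psnd (C (i + 1)) (D (i + 1)))).
by move=> i [x y]; apply/pair_equal_spec; split; rewrite /= ?sP ?tP.
Qed.

Lemma isoK_dsum C D C' D' : isoK C C' -> isoK D D' -> isoK (dsumC C D) (dsumC C' D').
Proof.
case=> f [f' [f'f ff']] [g [g' [g'g gg']]].
exists (dsum_map f g), (dsum_map f' g'); split.
  apply: homotopic_trans (_ : homotopic _ (dsum_map (compC f' f) (compC g' g))) _.
    exact: homotopic_eq.
  by apply: homotopic_trans (homotopic_dsum f'f g'g) _; apply: homotopic_eq => i [].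
apply: homotopic_trans (_ : homotopic _ (dsum_map (compC f f') (compC g g'))) _.
  exact: homotopic_eq.
by apply: homotopic_trans (homotopic_dsum ff' gg') _; apply: homotopic_eq => i [].
Qed.

End Homotopy.

Section Cones.
Variable R : nzRingType.
Implicit Types C D E : complex R.

Definition lower_tri C D C' D' (f : chmap C D) (f' : chmap C' D')
    (a : forall i, {linear C i -> C' i}) (b : forall i, {linear D i -> D' i})
    (h : forall i, {linear C (i + 1) -> D' i}) i : {linear cone f i -> cone f' i} :=
  ppair (a (i + 1) \o pfst (C (i + 1)) (D i)) (pcopair (h i) (b i)).

Lemma cone_mapP C D C' D' (f : chmap C D) (f' : chmap C' D') (a : chmap C C') (b : chmap D D')
    (h : forall i, {linear C (i + 1) -> D' i}) :
  (forall i x, compC b f (i + 1) x - compC f' a (i + 1) x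
               = diff D' i (h i x) + h (i + 1) (diff C (i + 1) x)) ->
  forall i z, @lower_tri C D C' D' f f' a b h (i + 1) (diff (cone f) i z)
              = diff (cone f') i (@lower_tri C D C' D' f f' a b h i z).
Proof.
move=> hP i [x y]; apply/pair_equal_spec; split; rewrite /= !linearN ?chmapP //.
have /eqP := hP i x; rewrite subr_eq => /eqP /= bf.
rewrite linearD bf chmapP linearD.
have E (V : zmodType) (p q r s : V) : - q + (p + q + r + s) = r + (p + s).
  by rewrite [p + q]addrC -!addrA addKr addrCA.
exact: E.
Qed.

Definition cone_map C D C' D' (f : chmap C D) (f' : chmap C' D') a b h hP :
  chmap (cone f) (cone f') := Chmap (@cone_mapP C D C' D' f f' a b h hP).

Lemma cone_diffE C D (f : chmap C D) i (z : cone f i) :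
  diff (cone f) i z = (- diff C (i + 1) z.1, f (i + 1) z.1 + diff D i z.2).
Proof. by []. Qed.

Local Lemma solve_corner (V : zmodType) (p q r s : V) : - r + p = s + q -> q + r = p - s.
Proof. by move=> e; apply/eqP; rewrite eq_sym subr_eq [q + r]addrC -addrA [q + s]addrC -e addNKr. Qed.

Local Lemma corner_cancel (V : zmodType) (p q b u v w z h1 h2 : V) :
  p - q = u + v -> b - q = w + z -> h1 + h2 = b - p -> u - w + h1 + (v - z + h2) = 0.
Proof.
move=> e1 e2 e3; rewrite addrACA [u - w + _]addrACA -opprD -e1 -e2 e3 opprB.
by rewrite subrKA subrKA subrr.
Qed.

Local Lemma entry_cancel (V : zmodType) (c d y u v w z : V) :
  d - y = u + v -> c + d - (w - z + c + y) = - w + u + (z + v).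
Proof.
move=> e; rewrite [RHS]addrACA -e opprD addrACA; congr (_ + _).
by rewrite opprD addrCA subrr addr0 opprD opprK.
Qed.

(* An endomorphism of a cone which is homotopic to the identity on the two
   diagonal entries is homotopic to a unipotent, hence invertible, one. *)
Lemma cone_endo_iso C D (f : chmap C D) (phi : chmap (cone f) (cone f))
    (a : chmap C C) (b : chmap D D) (h : forall i, {linear C (i + 1) -> D i}) :
  (forall i z, phi i z = (a (i + 1) z.1, h i z.1 + b i z.2)) ->
  homotopic a (idC C) -> homotopic b (idC D) -> is_isoK phi.
Proof.
move=> phiE [s sP] [t tP].
have hP i x : diff D i (h i x) + h (i + 1) (diff C (i + 1) x) =
    b (i + 1) (f (i + 1) x) - f (i + 1) (a (i + 1) x).
  have := chmapP phi (i := i) (x, 0); rewrite !phiE !cone_diffE /= !linear0 !addr0.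
  by move=> /(congr1 snd) /=; rewrite linearN; apply: solve_corner.
(* The corner entry left once the homotopy with diagonal entries [- s] and [t] has made the diagonal
   of [phi] the identity; the inverse matrix has corner [- n]. *)
pose n i : {linear C (i + 1) -> D i} := (f i \o s i) \- (t i \o f (i + 1)) \+ h i.
have nP i x : diff D i (n i x) + n (i + 1) (diff C (i + 1) x) = 0.
  rewrite /= linearD linearB; apply: (@corner_cancel _ _ (f (i + 1) x)) (hP i x).
    by have := congr1 (f (i + 1)) (sP i x); rewrite linearB linearD chmapP.
  by have := tP i (f (i + 1) x); rewrite -chmapP.
have lt g : (forall i x, diff D i (g i x) + g (i + 1) (diff C (i + 1) x) = 0) ->
    forall i x, compC (idC D) f (i + 1) x - compC f (idC C) (i + 1) x =
      diff D i (g i x) + g (i + 1) (diff C (i + 1) x).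
  by move=> gP i x; rewrite gP subrr.
have nNP i x : diff D i ((\- n i) x) + (\- n (i + 1)) (diff C (i + 1) x) = 0.
  by rewrite /= linearN -opprD nP oppr0.
pose psi := cone_map (lt (fun i => n i) nP); pose psi' := cone_map (lt (fun i => \- n i) nNP).
apply: (@is_isoK_homotopic _ _ _ psi).
  apply: homotopic_sym; exists (fun i => ppair (\- (s (i + 1) \o pfst (C (i + 1 + 1)) (D (i + 1))))
    (t i \o psnd (C (i + 1 + 1)) (D (i + 1)))) => i [x y].
  rewrite phiE; apply/pair_equal_spec; split=> /=.
    by rewrite !linearN !opprK; apply: sP.
  rewrite linearN (linearD (t (i + 1))); apply: entry_cancel.
  exact: (tP i y).
apply: (@isoK_strict _ _ _ psi psi') => i [x y]; apply/pair_equal_spec; split=> //=.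
  by rewrite addrA addNr add0r.
by rewrite addrA addrN add0r.
Qed.

(** Cone maps depend on the chosen homotopies, so the two cone maps need not be mutually inverse.
    Their composites are the identity on the diagonal up to homotopy, which suffices by
    [cone_endo_iso]. *)
Lemma isoK_cone C D C' D' (f : chmap C D) (f' : chmap C' D') (a : chmap C C') (b : chmap D D') :
  is_isoK a -> is_isoK b -> homotopic (compC b f) (compC f' a) -> isoK (cone f) (cone f').
Proof.
case=> a' [a'a aa'] [b' [b'b bb']] [h hP].
have [h' h'P] : homotopic (compC b' f') (compC f a').
  apply: homotopic_trans (homotopic_sym (homotopic_idr (compC b' f'))) _.
  apply: homotopic_trans (homotopic_compl (compC b' f') (homotopic_sym aa')) _.
  apply: homotopic_trans (_ : homotopic _ (compC b' (compC (compC f' a) a'))) _.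
    exact: homotopic_eq.
  have hh : homotopic (compC f' a) (compC b f) by apply: homotopic_sym; exists h.
  apply: homotopic_trans (homotopic_compl b' (homotopic_compr a' hh)) _.
  apply: homotopic_trans (_ : homotopic _ (compC (compC b' b) (compC f a'))) _.
    exact: homotopic_eq.
  by apply: homotopic_trans (homotopic_compr _ b'b) _; apply: homotopic_idl.
exists (cone_map hP); apply: (@isoK_factor _ _ _ _ (cone_map h'P) (cone_map h'P)).
  apply: (cone_endo_iso (h := fun i => (b' i \o h i) \+ (h' i \o a (i + 1))) _ a'a b'b) => i [x y].
  apply/pair_equal_spec; split=> //=.
  by rewrite linearD addrCA addrA.
apply: (cone_endo_iso (h := fun i => (b i \o h' i) \+ (h i \o a' (i + 1))) _ aa' bb') => i [x y].
apply/pair_equal_spec; split=> //=.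
by rewrite linearD addrCA addrA.
Qed.

End Cones.

(** * Comparison of projective resolutions *)

Section DescendingChoice.
Variables (T : int -> Type) (good : forall i, T i -> Prop).
Variables (rel : forall i, T (i + 1) -> T i -> Prop) (t : forall n, T (Posz n)).
Hypotheses (good0 : good (t 0))
  (step : forall n (s : T (Negz n + 1)), good s ->
     exists s' : T (Negz n), good s' /\ rel s s').

(** Dependent choice downwards from degree -1, the degrees from 0 on being prescribed; [good] is the
    invariant that keeps the next step possible. *)
Lemma descending_choice : exists h : forall i, T i,
  (forall n, h (Posz n) = t n) /\ forall n, rel (h (Negz n + 1)) (h (Negz n)).
Proof.
(* For a variable [n] the recursion has to transport the previous value along this equation. *)
have E n : Negz n = Negz n.+1 + 1 by case: n.
have next n (s : T (Negz n)) : good s ->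
    {s' : T (Negz n.+1) | good s' /\ rel (eq_rect _ T s _ (E n)) s'}.
  move=> gs; apply: cid; apply: step.
  by case: _ / (E n).
pose hn := fix hn n : {s : T (Negz n) | good s} := match n with
  | 0 => let s := cid (@step 0 (t 0) good0) in exist _ (sval s) (svalP s).1
  | m.+1 => let s := next m (sval (hn m)) (svalP (hn m)) in exist _ (sval s) (svalP s).1
  end.
pose h i : T i := match i with Posz n => t n | Negz n => sval (hn n) end.
exists h; split=> // -[|n]; first exact: (svalP (cid (@step 0 (t 0) good0))).2.
have castE i j (e : i = j) : eq_rect i T (h i) j e = h j by case: _ / e.
rewrite -(castE _ _ (E n)).
exact: (svalP (next n (sval (hn n)) (svalP (hn n)))).2.
Qed.

End DescendingChoice.

Section Comparison.
Variable R : nzRingType.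
Implicit Types (C D : complex R) (M N : lmodType R).

(** Cycles of the complex augmented by [eps]: in degree 0 this is ker eps, and above it there is no
    condition, the terms of a resolution being zero. *)
Definition augmented_cycle C (M : lmodType R) (eps : {linear C (Posz 0) -> M}) i : C i -> Prop :=
  match i with
  | Posz 0 => fun x => eps x = 0
  | Posz _ => fun x => True
  | Negz n => fun x => diff C (Negz n) x = 0
  end.

Lemma resolution_exact C M (eps : {linear C (Posz 0) -> M}) n (x : C (Negz n + 1)) :
  proj_resolution eps -> augmented_cycle eps x -> exists y, diff C (Negz n) y = x.
Proof.
case=> _ _ _ eps0 ex; case: n x => [|[|n]] x Zx; first exact/eps0.
  exact/(ex (Negz 1) erefl).
exact/(ex (Negz n.+2) erefl).
Qed.

Lemma resolution_cycle C M (eps : {linear C (Posz 0) -> M}) n (x : C (Negz n)) :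
  proj_resolution eps -> augmented_cycle eps (diff C (Negz n) x).
Proof.
case=> _ _ _ eps0 ex; case: n x => [|[|n]] x; first by apply/eps0; exists x.
  by apply/(ex (Negz 1) erefl); exists x.
by apply/(ex (Negz n.+2) erefl); exists x.
Qed.

Lemma resolution_lift C D M N (eps : {linear C (Posz 0) -> M}) (eps' : {linear D (Posz 0) -> N})
    (g : {linear M -> N}) : proj_resolution eps -> proj_resolution eps' ->
  exists f : chmap C D, forall x, eps' (f (Posz 0) x) = g (eps x).
Proof.
move=> res res'; have [prC _ _ _ _] := res; have [_ zD epsS' _ _] := res'.
have [f0 f0P] := (prC (Posz 0)).2 _ _ eps' (g \o eps) epsS'.
pose t n : {linear C (Posz n) -> D (Posz n)} := if n is 0 then f0 else \0.
have [||h [h0 hP]] := @descending_choice (fun i => {linear C i -> D i})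
  (fun i t => forall x, augmented_cycle eps x -> augmented_cycle eps' (t x))
  (fun i t s => forall x, t (diff C i x) = diff D i (s x)) t.
- by move=> x /= e0; rewrite f0P /= e0 linear0.
- move=> n s gs; have [|s' s'P] := @projective_lift _ _ _ _ (diff D (Negz n))
    (s \o diff C (Negz n)) (prC _).2.
    by move=> x; apply: resolution_exact res' _; apply: gs; apply: resolution_cycle.
  exists s'; split=> // x /= dx.
  by rewrite s'P /= dx linear0.
have hC i x : h (i + 1) (diff C i x) = diff D i (h i x).
  case: i x => n x; last exact: hP.
  by apply: etrans (esym _); apply: zD; rewrite ltzD1.
by exists (Chmap hC) => x; rewrite /= h0 /= f0P.
Qed.

Lemma resolution_homotopic C D M N (eps : {linear C (Posz 0) -> M})
    (eps' : {linear D (Posz 0) -> N}) (f g : chmap C D) :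
  proj_resolution eps -> proj_resolution eps' ->
  (forall x, eps' (f (Posz 0) x) = eps' (g (Posz 0) x)) -> homotopic f g.
Proof.
move=> res res' e; have [prC _ _ _ _] := res; have [_ zD _ _ _] := res'.
pose t n : {linear C (Posz n + 1) -> D (Posz n)} := \0.
(* [rel] is the homotopy equation, and [good] says that what must next be written as a boundary is a
   cycle. *)
have [||h [h0 hP]] := @descending_choice (fun i => {linear C (i + 1) -> D i})
  (fun i t => forall x, augmented_cycle eps' (f i x - g i x - t (diff C i x)))
  (fun i t s => forall x, f (i + 1) x - g (i + 1) x = diff D i (s x) + t (diff C (i + 1) x)) t.
- by move=> x /=; rewrite subr0 linearB e subrr.
- move=> n s gs; have [|s' s'P] := @projective_lift _ _ _ _ (diff D (Negz n))
    ((f (Negz n + 1) \- g (Negz n + 1)) \- (s \o diff C (Negz n + 1))) (prC _).2.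
    by move=> x; apply: resolution_exact res' _; apply: gs.
  exists s'; split=> [x|x] /=; last by rewrite s'P /= subrK.
  by rewrite !linearB -!chmapP s'P /= diffK linear0 subr0 subrr.
exists h => i x; case: i x => n x; last exact: hP.
by apply: etrans (esym _); apply: zD; rewrite ltzD1.
Qed.

Lemma resolution_unique C D M (eps : {linear C (Posz 0) -> M}) (eps' : {linear D (Posz 0) -> M}) :
  proj_resolution eps -> proj_resolution eps' -> isoK C D.
Proof.
move=> res res'; have [f fP] := resolution_lift idfun res res'.
have [g gP] := resolution_lift idfun res' res.
exists f, g; split; [apply: (resolution_homotopic res res)|apply: (resolution_homotopic res' res')].
  by move=> x; rewrite /= gP /= fP.
by move=> x; rewrite /= fP /= gP.
Qed.

End Comparison.

(** * Stalk complexes and approximations *)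

Section Stalks.
Variable R : nzRingType.
Implicit Types (C D X Y : complex R) (M N : lmodType R).

Lemma stalk_zero M i : i != 0 -> is_zero (stalk M i).
Proof. by case: i => [[|n]|n] // _; apply: zero_mod_is_zero. Qed.

Lemma stalk_diff0 M i x : diff (stalk M) i x = 0. Proof. by []. Qed.

Definition degree_zero C D (g : {linear C (Posz 0) -> D (Posz 0)}) i : {linear C i -> D i} :=
  match i with Posz 0 => g | _ => \0 end.

Lemma degree_zeroP M N (g : {linear M -> N}) i (x : stalk M i) :
  @degree_zero (stalk M) (stalk N) g (i + 1) (diff (stalk M) i x) =
  diff (stalk N) i (@degree_zero (stalk M) (stalk N) g i x).
Proof. by rewrite !stalk_diff0 linear0. Qed.

Definition stalk_map M N (g : {linear M -> N}) : chmap (stalk M) (stalk N) :=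
  Chmap (degree_zeroP g).

Lemma stalk_homotopic M N (f g : chmap (stalk M) (stalk N)) :
  homotopic f g <-> forall x, f (Posz 0) x = g (Posz 0) x.
Proof.
split=> [[h hP] x|e].
  by apply/eqP; rewrite -subr_eq0; have := hP (Negz 0) x => /= ->; rewrite linear0 addr0.
apply: homotopic_eq => i; have [->//|i0] := eqVneq i 0.
by move=> x; apply: etrans (esym _); apply: stalk_zero.
Qed.

Lemma isoK_stalk M N : iso_mod M N -> isoK (stalk M) (stalk N).
Proof.
case=> f [g [fK gK]]; exists (stalk_map f), (stalk_map g).
by split; apply/stalk_homotopic => x; [apply: fK|apply: gK].
Qed.

Lemma stalk_dsumP M N i (x : stalk (M * N)%type i) :
  @degree_zero (stalk (M * N)%type) (dsumC (stalk M) (stalk N)) idfun (i + 1)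
    (diff (stalk (M * N)%type) i x) =
  diff (dsumC (stalk M) (stalk N)) i
    (@degree_zero (stalk (M * N)%type) (dsumC (stalk M) (stalk N)) idfun i x).
Proof. by rewrite stalk_diff0 linear0. Qed.

Lemma dsum_stalkP M N i (x : dsumC (stalk M) (stalk N) i) :
  @degree_zero (dsumC (stalk M) (stalk N)) (stalk (M * N)%type) idfun (i + 1)
    (diff (dsumC (stalk M) (stalk N)) i x) =
  diff (stalk (M * N)%type) i
    (@degree_zero (dsumC (stalk M) (stalk N)) (stalk (M * N)%type) idfun i x).
Proof. by rewrite stalk_diff0 [diff _ _ x](_ : _ = 0) ?linear0. Qed.

Lemma isoK_stalk_dsum M N : isoK (stalk (M * N)%type) (dsumC (stalk M) (stalk N)).
Proof.
exists (Chmap (@stalk_dsumP M N)); apply: (isoK_strict (g := Chmap (@dsum_stalkP M N))).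
  move=> i; have [->//|i0] := eqVneq i 0.
  by move=> x; apply: etrans (esym _); apply: stalk_zero.
move=> i; have [->//|i0] := eqVneq i 0.
by move=> x; apply: etrans (esym _); apply: is_zero_prod; apply: stalk_zero.
Qed.

Lemma in_Kb_proj_stalk M : fin_gen M -> projective M -> in_Kb_proj (stalk M).
Proof.
move=> fM pM; split; last by exists 0 => i i0; apply: stalk_zero; rewrite -absz_gt0.
move=> i; have [->//|i0] := eqVneq i 0.
by split; [apply: is_zero_fin_gen|apply: is_zero_projective]; apply: stalk_zero.
Qed.

Lemma in_Kb_proj_dsum C D : in_Kb_proj C -> in_Kb_proj D -> in_Kb_proj (dsumC C D).
Proof.
move=> [pC [m zC]] [pD [n zD]]; split=> [i|].
  have [fC prC] := pC i; have [fD prD] := pD i.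
  by split; [apply: fin_gen_prod|apply: projective_prod].
exists (maxn m n) => i; rewrite gtn_max => /andP[mi ni].
by apply: is_zero_prod; [apply: zC|apply: zD].
Qed.

Lemma in_Kb_proj_cone C D (f : chmap C D) : in_Kb_proj C -> in_Kb_proj D -> in_Kb_proj (cone f).
Proof.
move=> [pC [m zC]] [pD [n zD]]; split=> [i|].
  have [fC prC] := pC (i + 1); have [fD prD] := pD i.
  by split; [apply: fin_gen_prod|apply: projective_prod].
exists (maxn m.+1 n) => i; rewrite gtn_max => /andP[mi ni].
apply: is_zero_prod; [apply: zC|exact: zD].
by case: i mi {ni} => [i /= mi|[|[|i]]//]; rewrite addn1 ltnS (leq_trans _ mi) // leqW.
Qed.

End Stalks.

Section Approximation.
Variable R : nzRingType.
Implicit Types (C D X Y : complex R) (M N : lmodType R).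

Lemma proj1_chmapP C D i (x : dsumC C D i) :
  pfst (C (i + 1)) (D (i + 1)) (diff (dsumC C D) i x) = diff C i (pfst (C i) (D i) x).
Proof. by []. Qed.
Definition dsum_fst C D : chmap (dsumC C D) C := @Chmap R (dsumC C D) C _ (@proj1_chmapP C D).

Lemma proj2_chmapP C D i (x : dsumC C D i) :
  psnd (C (i + 1)) (D (i + 1)) (diff (dsumC C D) i x) = diff D i (psnd (C i) (D i) x).
Proof. by []. Qed.
Definition dsum_snd C D : chmap (dsumC C D) D := @Chmap R (dsumC C D) D _ (@proj2_chmapP C D).

Lemma inj1_chmapP C D i (x : C i) :
  pinl (C (i + 1)) (D (i + 1)) (diff C i x) = diff (dsumC C D) i (pinl (C i) (D i) x).
Proof. by apply/pair_equal_spec; split; rewrite ?linear0. Qed.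
Definition dsum_inl C D : chmap C (dsumC C D) := @Chmap R C (dsumC C D) _ (@inj1_chmapP C D).

Lemma ppair_chmapP C D X (f : chmap X C) (g : chmap X D) i (x : X i) :
  ppair (f (i + 1)) (g (i + 1)) (diff X i x) = diff (dsumC C D) i (ppair (f i) (g i) x).
Proof. by rewrite /= !chmapP. Qed.
Definition dsum_pair C D X (f : chmap X C) (g : chmap X D) : chmap X (dsumC C D) :=
  @Chmap R X (dsumC C D) _ (ppair_chmapP f g).

Lemma homotopic_dsum_pair C D X (f f' : chmap X C) (g g' : chmap X D) :
  homotopic f f' -> homotopic g g' -> homotopic (dsum_pair f g) (dsum_pair f' g').
Proof.
case=> s sP [t tP]; exists (fun i => ppair (s i) (t i)) => i x.
by apply/pair_equal_spec; split; rewrite /= ?sP ?tP.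
Qed.

Lemma in_add_approx (M' : complex R) X D (f : chmap X D) :
  (forall g : chmap X M', exists h, homotopic (compC h f) g) ->
  forall D', in_add M' D' -> forall g : chmap X D', exists h, homotopic (compC h f) g.
Proof.
move=> base D'; elim=> {D'} [//||C1 C2 _ IH1 _ IH2|C1 C2 _ _ _ IH|C1 C2 _ [u [v [vu uv]]] _ IH] g.
- have zero i : is_zero (stalk (zero_mod R) i) by case: i => [[|n]|n]; apply: zero_mod_is_zero.
  have cP i (x : D i) : (\0 : {linear D (i + 1) -> stalk (zero_mod R) (i + 1)}) (diff D i x) =
      diff (stalk (zero_mod R)) i ((\0 : {linear D i -> stalk (zero_mod R) i}) x) by [].
  exists (Chmap cP); apply: homotopic_eq => i x.
  by rewrite (zero i (g i x)).
- have [h1 h1P] := IH1 (compC (dsum_fst C1 C2) g).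
  have [h2 h2P] := IH2 (compC (dsum_snd C1 C2) g).
  exists (dsum_pair h1 h2).
  apply: homotopic_trans (_ : homotopic _ (dsum_pair (compC h1 f) (compC h2 f))) _.
    exact: homotopic_eq.
  apply: homotopic_trans (homotopic_dsum_pair h1P h2P) _.
  by apply: homotopic_eq => i x /=; case: (g i x).
- have [h hP] := IH (compC (dsum_inl C1 C2) g); exists (compC (dsum_fst C1 C2) h).
  apply: homotopic_trans (homotopic_assoc _ _ _) _.
  by apply: homotopic_trans (homotopic_compl _ hP) _; apply: homotopic_eq.
- have [h hP] := IH (compC v g); exists (compC u h).
  apply: homotopic_trans (homotopic_assoc _ _ _) _.
  apply: homotopic_trans (homotopic_compl _ hP) _.
  apply: homotopic_trans (homotopic_sym (homotopic_assoc _ _ _)) _.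
  by apply: homotopic_trans (homotopic_compr _ uv) _; apply: homotopic_idl.
Qed.

(** The two approximations factor through each other, and minimality makes both composites
    isomorphisms; the square carries this to the cones. *)
Lemma minimal_approx_cone (M' N : complex R) X D (f : chmap X D) D' (f' : chmap X D') g' h' :
  left_approx M' f -> left_minimal f -> left_approx M' f' -> left_minimal f' ->
  @distinguished R X D' N f' g' h' -> isoK N (cone f).
Proof.
move=> [addD fA] fM [addD' f'A] f'M [X'' [D'' [f'' [a [b [c [[isoa isob isoc] sq _ _]]]]]]].
have [u uP] := fA D' f' addD'; have [v vP] := f'A D f addD.
have vu : is_isoK (compC v u).
  apply: fM; apply: homotopic_trans (homotopic_assoc _ _ _) _.
  exact: homotopic_trans (homotopic_compl _ uP) vP.
have uv : is_isoK (compC u v).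
  apply: f'M; apply: homotopic_trans (homotopic_assoc _ _ _) _.
  exact: homotopic_trans (homotopic_compl _ vP) uP.
have isou := isoK_factor vu uv.
apply: isoK_trans (ex_intro _ c isoc) _; apply: isoK_sym.
apply: (isoK_cone isoa (is_isoK_comp isob isou)).
apply: homotopic_trans (homotopic_assoc _ _ _) _.
exact: homotopic_trans (homotopic_compl _ uP) sq.
Qed.

Lemma cone_distinguished X D (f : chmap X D) : distinguished f (cone_in f) (cone_out f).
Proof.
exists X, D, f, (idC X), (idC D), (idC (cone f)); split.
- by split; apply: (isoK_strict (g := idC _)).
- exact: homotopic_eq.
- exact: homotopic_eq.
- exact: homotopic_eq.
Qed.

(** The decomposition makes [D] a retract of a finite power [Z] of [E]; the complement is again a
    finitely generated projective, as [add_summand] demands. *)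
Lemma in_add_stalk (E D : lmodType R) (I : Type) (r : seq I)
    (a : I -> {linear D -> E}) (b : I -> {linear E -> D}) :
  fin_gen D -> projective D -> fin_gen E -> projective E ->
  (forall c, c = \sum_(i <- r) b i (a i c)) -> in_add (stalk E) (stalk D).
Proof.
move=> fD pD fE pE dec.
have [Z [al [be [addZ fgZ prZ alP]]]] : exists (Z : lmodType R) (al : {linear D -> Z})
    (be : {linear Z -> D}), [/\ in_add (stalk E) (stalk Z), fin_gen Z, projective Z &
      forall c, be (al c) = \sum_(i <- r) b i (a i c)].
  elim: r {dec} => [|i r [Z [al [be [addZ fgZ prZ alP]]]]].
    exists (zero_mod R), \0, \0; split=> [|||c]; last by rewrite big_nil.
    - exact: add_zero.
    - exact: is_zero_fin_gen (@zero_mod_is_zero R).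
    - exact: is_zero_projective (@zero_mod_is_zero R).
  exists (E * Z)%type, (ppair (a i) al), (pcopair (b i) be); split=> [|||c].
  - apply: add_iso (isoK_sym (isoK_stalk_dsum E Z)) _; last by apply: add_sum => //; apply: add_gen.
    by apply: in_Kb_proj_stalk; [apply: fin_gen_prod|apply: projective_prod].
  - exact: fin_gen_prod.
  - exact: projective_prod.
  - by rewrite big_cons -alP.
have alK : cancel al be by move=> c; rewrite alP -dec.
have [Y [j [[f [g [fK gK]]] _ _]]] := retract_summand alK.
have fY : fin_gen Y.
  by apply: (@fin_gen_surj _ _ _ (psnd D Y \o f)) fgZ => y; exists (g (0, y)); rewrite /= gK.
have pY : projective Y.
  move=> U V q h qS; have [l lP] := prZ _ _ q (h \o (psnd D Y \o f)) qS.
  by exists (l \o (g \o pinr D Y)) => y; rewrite /= lP /= gK.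
apply: (@add_summand _ _ _ (stalk Y)); [exact: in_Kb_proj_stalk..|].
have kDY : in_Kb_proj (dsumC (stalk D) (stalk Y)).
  by apply: in_Kb_proj_dsum; apply: in_Kb_proj_stalk.
apply: add_iso kDY _ addZ; apply: isoK_trans (isoK_stalk_dsum D Y).
by apply: isoK_stalk; exists f, g.
Qed.

End Approximation.

(** * The mutation and the tilting module *)

Section ApproximationCone.
Variables (R : nzRingType) (X E D M : lmodType R) (f : {linear X -> D}) (g : {linear D -> M}).
Hypotheses (fgX : fin_gen X) (prX : projective X) (fgE : fin_gen E) (prE : projective E).
Hypothesis seqP : approx_sequence E f g.

(** Degree 0 is [(zero_mod * D) * E] and degree -1 is [(X * zero_mod) * zero_mod], which explains
    the nested projections below. *)
Definition approx_complex : complex R := dsumC (cone (stalk_map f)) (stalk E).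

Definition approx_augmentation : {linear approx_complex (Posz 0) -> (M * E)%type} :=
  ppair (g \o (psnd (zero_mod R) D \o pfst (zero_mod R * D)%type E))
        (psnd (zero_mod R * D)%type E).

Lemma in_Kb_proj_approx_cone : in_Kb_proj (cone (stalk_map f)).
Proof.
case: seqP => [[[fD pD] _ _ _] _ _ _ _].
by apply: in_Kb_proj_cone; apply: in_Kb_proj_stalk.
Qed.

Lemma in_Kb_proj_approx : in_Kb_proj approx_complex.
Proof.
by apply: in_Kb_proj_dsum; [apply: in_Kb_proj_approx_cone|apply: in_Kb_proj_stalk].
Qed.

Lemma approx_complex_zero i : i + 1 != 0 -> i != 0 -> is_zero (approx_complex i).
Proof. by move=> i1 i0; apply: is_zero_prod; [apply: is_zero_prod|]; apply: stalk_zero. Qed.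

Lemma approx_resolution : proj_resolution approx_augmentation.
Proof.
case: seqP => [[_ fI gS gP] _ _ _ _]; case: in_Kb_proj_approx => pr _; split=> //.
- by move=> [[|n]|n] // _; apply: approx_complex_zero.
- by move=> [m t]; have [c <-] := gS m; exists ((0, c), t).
- move=> [[z c] t]; split=> [/pair_equal_spec[/= gc t0]|[[[u w] s] <-]].
    have [u fu] := (gP c).1 gc; exists ((u, 0), 0).
    apply/pair_equal_spec; split; last by rewrite t0.
    by apply/pair_equal_spec; split; [apply: etrans (esym _); apply: zero_mod_is_zero|rewrite /= fu addr0].
  by apply/pair_equal_spec; split=> //=; apply/gP; exists u; rewrite addr0.
- move=> [n|[|[|n]]] // _ x; split=> [dx|[y <-]]; try exact: diffK.
    exists 0; rewrite linear0; case: x dx => [[u w] t] /(congr1 (fun z => z.1.2)) /=.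
    rewrite addr0 => fu; have u0 : u = 0 by apply: fI; rewrite linear0.
    apply/pair_equal_spec; split; last by symmetry; apply: zero_mod_is_zero.
    by apply/pair_equal_spec; split; [|symmetry; apply: zero_mod_is_zero].
  by exists 0; rewrite linear0; symmetry; apply: approx_complex_zero; case: (n).
Qed.

Lemma approx_pd_le1 : pd_le 1 (M * E)%type.
Proof.
exists approx_complex, approx_augmentation; split; first exact: approx_resolution.
by move=> [n|[|n]] // _; apply: approx_complex_zero; case: n.
Qed.

Lemma approx_left_approx : left_approx (stalk E) (stalk_map f).
Proof.
case: seqP => [[[fD pD] _ _ _] [I [a [b ab]]] ext _ _]; split; first exact: in_add_stalk ab.
move=> D' h addD'; apply: in_add_approx addD' h => h.
have [h' h'P] := ext (h (Posz 0)); exists (stalk_map h').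
by apply/stalk_homotopic => x; apply: h'P.
Qed.

Lemma approx_finite_length : (forall N : lmodType R, fin_gen N -> finite_length N) ->
  finite_length D.
Proof. by apply; case: seqP => [[[]]]. Qed.

Lemma approx_left_minimal : finite_length D -> left_minimal (stalk_map f).
Proof.
case: seqP => _ _ _ min _ Dfl h /stalk_homotopic hf.
have hI := min (h (Posz 0)) hf; have [h' [hK h'K]] := bij_inv hI (inj_endo_surj Dfl hI).
by exists (stalk_map h'); split; apply/stalk_homotopic => x; [apply: hK|apply: h'K].
Qed.

Lemma approx_extend (h : {linear X -> D}) : exists h' : {linear D -> D}, forall u, h' (f u) = h u.
Proof.
have [addD ext] := approx_left_approx; have [h' h'P] := ext _ (stalk_map h) addD.
by exists (h' (Posz 0)); apply/(stalk_homotopic (compC h' (stalk_map f)) (stalk_map h)).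
Qed.

(** Tested on X -> D * E -> M * E. The component of a map in [M] lifts through [g] to [D], where it
    extends along [f] because [D] is in add E. *)
Lemma approx_Ext1_zero : Ext1_zero (M * E)%type (M * E)%type.
Proof.
case: seqP => [[[_ pD] fI gS gP] _ ext _ _].
apply: (@Ext1_of_extend _ _ _ (D * E)%type X (ppair (g \o pfst D E) (psnd D E)) (pinl D E \o f)).
- exact: projective_prod.
- by move=> [m t]; have [c <-] := gS m; exists (c, t).
- move=> [c t]; split=> [/pair_equal_spec[/= gc t0]|[u /pair_equal_spec[/= fu t0]]].
    by have [u <-] := (gP c).1 gc; exists u; rewrite /= t0.
  by apply/pair_equal_spec; split=> //=; apply/gP; exists u.
move=> h; have [l lP] := prX (pfst M E \o h) gS.
have [l' l'P] := approx_extend l; have [t tP] := ext (psnd M E \o h).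
exists (ppair (g \o l') t \o pfst D E) => u /=.
by rewrite l'P lP tP /=; case: (h u).
Qed.

Lemma approx_not_projective : ~ projective M.
Proof.
case: seqP => [[[_ pD] fI gS gP] _ _ _ nonsplit] pM; apply: nonsplit.
have [s sP] := pM _ _ g idfun gS.
have [|r rP] := @projective_lift _ _ _ _ f (idfun \- (s \o g)) pD.
  by move=> c; apply/gP; rewrite /= linearB sP subrr.
exists r => u; apply: fI; rewrite rP /=.
have -> : g (f u) = 0 by apply/gP; exists u.
by rewrite linear0 subr0.
Qed.

(** Invertibility passes from X to M: if [w] extends f u^-1 along [f], then w v f = f, so minimality
    makes w v invertible and [v] onto. *)
Lemma approx_endo_surj (p : {linear M -> M}) (v : {linear D -> D}) (u : {linear X -> X}) :
  finite_length D -> finite_length X -> (forall c, g (v c) = p (g c)) ->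
  (forall x, f (u x) = v (f x)) -> injective u -> surj p.
Proof.
case: seqP => [[_ _ gS _] _ _ min _] Dfl Xfl gv fu uI.
have [u' [uK _]] := bij_inv uI (inj_endo_surj Xfl uI).
have [w wP] := approx_extend (f \o u').
have wvI : injective (w \o v) by apply: min => x; rewrite /= -fu wP /= uK.
have vS : surj v by apply: (inj_endo_surj Dfl) => x y e; apply: wvI; rewrite /= e.
by move=> m; have [c <-] := gS m; have [c' <-] := vS c; exists (g c'); rewrite gv.
Qed.

(** The projection onto a summand of [M] lifts to [v] on [D] and [u] on [X]. As [X] has local
    endomorphisms, [u] or its complement is invertible, so one of the two projections of [M] is
    onto. *)
Lemma approx_indec : finite_length D -> finite_length X -> indecomposable X -> indecomposable M.
Proof.
move=> Dfl Xfl Xind; have [[[_ pD] fI gS gP] _ _ _ _] := seqP; split.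
  by move=> M0; apply: approx_not_projective; apply: is_zero_projective.
move=> Y Z [F [G [FK GK]]].
pose p := G \o (pinl Y Z \o (pfst Y Z \o F)); pose p' := G \o (pinr Y Z \o (psnd Y Z \o F)).
have pp' m : p m + p' m = m by rewrite -[RHS]FK [in RHS](pinlrE (F m)) linearD.
have [v vP] := pD _ _ g (p \o g) gS.
have [|u uP] := @projective_lift _ _ _ _ f (v \o f) prX.
  move=> x; apply/gP; rewrite /= vP /=.
  have -> : g (f x) = 0 by apply/gP; exists x.
  by rewrite !linear0.
have [||uI|uI] := @inj_add _ X Xfl Xind u (idfun \- u) idfun; first exact: inj_id.
- by move=> x /=; rewrite addrC subrK.
- right=> z; have [m mE] := approx_endo_surj Dfl Xfl vP uP uI (G (0, z)).
  by have := congr1 F mE; rewrite /= !GK => /(congr1 snd).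
- left=> y; have [||m mE] := @approx_endo_surj p' (idfun \- v) (idfun \- u) Dfl Xfl _ _ uI (G (y, 0)).
  + by move=> c; rewrite /= linearB vP -[X in X - _]pp' addrC addKr.
  + by move=> x; rewrite /= linearB uP.
  by have := congr1 F mE; rewrite /= !GK => /(congr1 fst).
Qed.

End ApproximationCone.

Lemma summand_retract (R : nzRingType) (X M : lmodType R) : is_summand X M ->
  exists (a : {linear X -> M}) (b : {linear M -> X}), cancel a b.
Proof.
move=> [Y [F [G [FK GK]]]]; exists (G \o pinl X Y), (pfst X Y \o F) => x.
by rewrite /= GK.
Qed.

Lemma retract_is_summand (R : nzRingType) (X M : lmodType R)
  (a : {linear X -> M}) (b : {linear M -> X}) : cancel a b -> is_summand X M.
Proof. by move=> /retract_summand[Y [_ [e _ _]]]; exists Y. Qed.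

(** * Counting the indecomposable summands of A and T *)

Section Decomposition.
Variables (k : fieldType) (A : falgType k) (e : A).
Hypothesis pe : primitive_idempotent e.
Let he := primitive_idem pe.
Let he' := compl_idem pe.

Lemma idem_compl_sum (a : A) : e * a + (1 - e) * a = a.
Proof. by rewrite -mulrDl addrC subrK mul1r. Qed.

Lemma reg_iso_prod : iso_mod (reg_right A) (eA e * eA (1 - e))%type.
Proof.
exists (ppair (eA_proj he) (eA_proj he')), (pcopair eA_val eA_val); split=> [a|[x y]].
  rewrite -[LHS]/(eA_val (eA_proj he a) + eA_val (eA_proj he' a)) !eA_projE.
  exact: idem_compl_sum.
have ort1 (z : eA (1 - e)) : e * (eA_val z : A) = 0.
  by rewrite -(eA_valE he' z) mulrA mulrBr mulr1 (he : e * e = e) subrr mul0r.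
have ort2 (z : eA e) : (1 - e) * (eA_val z : A) = 0.
  by rewrite -(eA_valE he z) mulrA mulrBl mul1r (he : e * e = e) subrr mul0r.
apply/pair_equal_spec; split; apply: eA_val_inj; rewrite eA_projE.
  by rewrite -[LHS]/(e * (eA_val x + eA_val y)) mulrDr ort1 addr0 eA_valE.
by rewrite -[LHS]/((1 - e) * (eA_val x + eA_val y)) mulrDr ort2 add0r eA_valE.
Qed.

Lemma not_summand_complement : basic_algebra A ->
  forall (a : {linear eA e -> eA (1 - e)}) (b : {linear eA (1 - e) -> eA e}), cancel a b -> False.
Proof.
move=> [n [f [fprim _ fsum fdist]]] a b aK.
apply: (@reg_multiplicity_one _ _ n f fprim fsum fdist (eA e) (eA_finite_length he)
  (primitive_indec pe) eA_val (eA_val \o a) (eA_proj he) (b \o eA_proj he')).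
- exact: eA_valK.
- by move=> x; rewrite /= eA_valK aK.
- move=> x; rewrite /=; have -> : eA_proj he' (eA_val x) = 0; last exact: linear0.
  apply: eA_val_inj; rewrite eA_projE linear0 -(eA_valE he x) mulrA.
  by rewrite mulrBl mul1r (he : e * e = e) subrr mul0r.
Qed.

Lemma num_indec_reg n (f : 'I_n -> A) : (forall i, primitive_idempotent (f i)) ->
  \sum_i f i = 1 -> (forall i j, iso_mod (eA (f i)) (eA (f j)) -> i = j) ->
  num_indec_summands (reg_right A) n.
Proof.
move=> fprim fsum fdist; exists (fun i => eA (f i)); split=> [i||Y indY sumY].
- split; first exact: primitive_indec.
  by apply: (retract_is_summand (a := eA_val) (b := eA_proj (primitive_idem (fprim i)))); apply: eA_valK.
- exact: fdist.
have [a [b aK]] := summand_retract sumY.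
apply: (indec_summand_reg fprim fsum _ indY aK).
exact: finite_length_inj (can_inj aK) (falg_finite_length (reg_right_fin_gen A)).
Qed.

Lemma num_indec_exchange (M : right_mod A) n (f : 'I_n -> A) : basic_algebra A ->
  (forall i, primitive_idempotent (f i)) ->
  \sum_i f i = 1 -> (forall i j, iso_mod (eA (f i)) (eA (f j)) -> i = j) ->
  fin_gen M -> indecomposable M -> ~ projective M ->
  num_indec_summands (M * eA (1 - e))%type n.
Proof.
move=> basicA fprim fsum fdist fgM indM npM.
have hf i := primitive_idem (fprim i).
have Xfl := eA_finite_length he; have Xind := primitive_indec pe.
have [j eAj] := indec_summand_reg fprim fsum Xfl Xind (eA_valK he).
have retr i : i != j -> exists (a : {linear eA (f i) -> eA (1 - e)})
      (b : {linear eA (1 - e) -> eA (f i)}), cancel a b.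
  move=> ij; have Yfl := eA_finite_length (hf i); have Yind := primitive_indec (fprim i).
  (* The identity of [eA (f i)] splits into its passages through eA and (1-e)A; if the first is
     injective, then [eA (f i)] is isomorphic to eA, so i = j. *)
  have [||h|h] := @inj_add _ _ Yfl Yind
    ((eA_proj (hf i) \o eA_val) \o (eA_proj he \o eA_val))
    ((eA_proj (hf i) \o eA_val) \o (eA_proj he' \o eA_val)) idfun; first exact: inj_id.
  - move=> x; rewrite -[LHS](eA_valK (hf i)) -(idem_compl_sum (eA_val x)) -!eA_projE.
    exact: linearD.
  - have [b aK] := inj_endo_retract Yfl h.
    case/eqP: ij; apply: fdist; apply: iso_trans eAj.
    by apply: bij_iso (can_inj aK) (retract_indec aK _ Xind); case: Yind.
  - by have [b aK] := inj_endo_retract Yfl h; exists (eA_proj he' \o eA_val), b.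
exists (fun i => if i == j then M else eA (f i)); split=> [i|i i'|Y Yind Ysum].
- case: (eqVneq i j) => [_|ij].
    split=> //; apply: (retract_is_summand (a := pinl M (eA (1 - e))) (b := pfst M (eA (1 - e)))).
    by [].
  split; first exact: primitive_indec.
  have [a [b aK]] := retr i ij.
  apply: (retract_is_summand (a := pinr M (eA (1 - e)) \o a) (b := b \o psnd M (eA (1 - e)))).
  by move=> x; rewrite /= aK.
- have nM l : iso_mod (eA (f l)) M -> False.
    move=> [u [v [uK vK]]]; apply: npM => U V q h qS.
    have [t tP] := eA_projective (hf l) (h \o u) qS.
    by exists (t \o v) => m; rewrite /= tP /= vK.
  case: (eqVneq i j) (eqVneq i' j) => [->|_] [->|_] //.
  + by move=> /iso_sym /nM.
  + by move=> /nM.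
  + exact: fdist.
have [a [b aK]] := summand_retract Ysum.
have Yfl : finite_length Y.
  by apply: finite_length_inj (can_inj aK) _; apply: falg_finite_length;
     apply: fin_gen_prod => //; apply: eA_fin_gen he'.
have Yn0 : ~ is_zero Y by case: Yind.
have [||h|h] := @inj_add _ Y Yfl Yind ((b \o pinl M _) \o (pfst M (eA (1 - e)) \o a))
   ((b \o pinr M _) \o (psnd M (eA (1 - e)) \o a)) idfun; first exact: inj_id.
- by move=> y; rewrite -[LHS]aK [in LHS](pinlrE (a y)) linearD.
- have [c cK] := inj_endo_retract Yfl h; exists j; rewrite eqxx.
  exact: bij_iso (can_inj cK) (retract_indec cK Yn0 indM).
have [c cK] := inj_endo_retract Yfl h.
have [|i iY] := @indec_summand_reg _ _ n f fprim fsum Y Yfl Yind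
  (eA_val \o (psnd M (eA (1 - e)) \o a)) (c \o eA_proj he').
  by move=> y; rewrite /= eA_valK; apply: cK.
(* The index [j] would make [Y] isomorphic to eA and thus eA a retract of (1-e)A. *)
exists i; case: eqVneq => // ij; exfalso; subst i.
have [u [v [uK vK]]] := iso_trans eAj (iso_sym iY).
apply: (not_summand_complement basicA (a := (psnd M (eA (1 - e)) \o a) \o u) (b := v \o c)).
by move=> x; rewrite /= [c _]cK uK.
Qed.

End Decomposition.

Theorem theorem2p53 (k : fieldType) (A : falgType k) (e : A)
    (S tauS : lmodType A^c) :
  basic_algebra A ->
  indecomposable_bimod A ->
  primitive_idempotent e ->
  is_top (eA e) S ->
  is_tau_inv S tauS ->
  Ext1_zero S S ->
  pd_le 1 tauS ->
  ~ injective_mod S ->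
  let T : lmodType A^c := (tauS * eA (1 - e))%type in
  ((exists P, represents P T) /\
   (exists L, is_left_mutation
      (stalk (reg_right A)) (stalk (eA e)) (stalk (eA (1 - e))) L) /\
   (forall P L, represents P T ->
      is_left_mutation
        (stalk (reg_right A)) (stalk (eA e)) (stalk (eA (1 - e))) L ->
      isoK P L)) /\
  is_tilting_pd1 T.
Proof.
move=> basicA _ pe topS tauP extS pdS ninjS T.
have he := primitive_idem pe; have he' := compl_idem pe.
have fgX := eA_fin_gen he; have prX := eA_projective he.
have fgE := eA_fin_gen he'; have prE := eA_projective he'.
have [D [f [g seqP]]] := exists_approx_sequence basicA pe topS tauP extS pdS ninjS.
have Dfl := approx_finite_length seqP (@falg_finite_length _ A).
have res := approx_resolution fgX prX fgE prE seqP.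
have LA := approx_left_approx fgE prE seqP.
have LM := approx_left_minimal seqP Dfl.
have kb := in_Kb_proj_approx fgX prX fgE prE seqP.
split; [split; [|split]|].
- by exists (approx_complex (eA (1 - e)) f); split=> //; exists (approx_augmentation (eA (1 - e)) f g).
- exists (approx_complex (eA (1 - e)) f); split=> //; split.
    exact: isoK_trans (isoK_stalk (reg_iso_prod pe)) (isoK_stalk_dsum _ _).
  exists (stalk D), (cone (stalk_map f)), (stalk_map f), (cone_in _), (cone_out _); split=> //.
  + exact: in_Kb_proj_approx_cone seqP.
  + exact: cone_distinguished.
  + exact: isoK_refl.
(* Both sides are compared with [approx_complex]: [P] as a resolution of T, and [L] through the cone
   of its own minimal approximation. *)
- move=> P L [_ [eps epsP]] [_ [_ [D' [N [f' [g' [h' [_ LA' LM' tri isoL]]]]]]]].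
  apply: isoK_trans (resolution_unique epsP res) _; apply: isoK_sym.
  apply: isoK_trans isoL _; apply: isoK_dsum (isoK_refl _).
  exact: minimal_approx_cone LA LM LA' LM' tri.
case: (seqP) => [[[fgD _] _ gS _] _ _ _ _].
have fgM := fin_gen_surj gS fgD.
split; first exact: fin_gen_prod.
- exact: approx_pd_le1 seqP.
- exact: approx_Ext1_zero seqP.
have [n [F [Fprim _ Fsum Fdist]]] := basicA; exists n; split.
  apply: (num_indec_exchange pe basicA Fprim Fsum Fdist fgM).
    exact: approx_indec seqP Dfl (eA_finite_length he) (primitive_indec pe).
  exact: approx_not_projective seqP.
exact: num_indec_reg Fsum Fdist.
Qed.
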